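(* Let $\mathcal C$ be a modular fusion category (over $\mathbb C$). Then $K(\mathcal C)$ is Burnside if and only if it is dual-Burnside.
   Context: $X_1,\dots,X_m$ are representatives of the isomorphism classes of simple objects of $\mathcal C$, $x_i=[X_i]\in K(\mathcal C)$ (the Grothendieck ring), $d_i=\mathrm{FPdim}(X_i)$ the Frobenius–Perron dimension. Let $H=K(\mathcal C)\otimes\mathbb C$ and let $\widehat{\mathcal B}=\{\mu_1=\mathrm{FPdim},\mu_2,\dots,\mu_m\}$ be the set of unital algebra morphisms $H\to\mathbb C$, a basis of $H^*$. $x_i$ is grouplike if $x_i[X_i^*]=1$ (equivalently $X_i$ invertible). $K(\mathcal C)$ is Burnside if for every $i$: there is $\mu\in\widehat{\mathcal B}$ with $\mu(x_i)=0$ if and only if $x_i$ is not grouplike. The dual hypergroup of $K(\mathcal C)$ is $H^*$ with basis $\widehat{\mathcal B}$, product $(f\star g)(x_i/d_i)=f(x_i/d_i)g(x_i/d_i)$ for all $i$, unit $\mu_1$, involution $\mu_{j^\#}(x_i)=\mu_j([X_i^*])$. Write $\mu_i\star\mu_j=\sum_k\widehat p_k(i,j)\mu_k$; $\mu_j$ is grouplike in the dual if $\mu_j\star\mu_{j^\#}=\widehat p_1(j,j^\#)\mu_1$. $K(\mathcal C)$ is dual-Burnside if for every $\mu_j\in\widehat{\mathcal B}$: there is $i$ with $\mu_j(x_i)=0$ if and only if $\mu_j$ is not grouplike in the dual. *)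

(* Defs.v *)
From HB Require Import structures.
From mathcomp Require Import all_boot all_order all_algebra.
From mathcomp Require Import all_classical all_reals.
From mathcomp Require Import complex.

Set Implicit Arguments.
Unset Strict Implicit.
Unset Printing Implicit Defensive.

Import GRing.Theory.
Local Open Scope ring_scope.

(** * Linear, abelian and semisimple categories *)

Declare Scope cat_scope.
Delimit Scope cat_scope with cat.
Local Open Scope cat_scope.

Reserved Notation "g \oc f" (at level 50, left associativity).
Reserved Notation "X \ox Y" (at level 40, left associativity).
Reserved Notation "f \oh g" (at level 40, left associativity).

(* Morphism spaces are finite-dimensional; [mcomp g f] is g after f. *)
Record linear_category (k : fieldType) := LinearCategory {
  obj :> Type;
  mor : obj -> obj -> vectType k;
  mid : forall X : obj, mor X X;
  mcomp : forall X Y Z : obj, mor Y Z -> mor X Y -> mor X Z;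
  mcompA : forall (W X Y Z : obj) (h : mor Y Z) (g : mor X Y) (f : mor W X),
    mcomp h (mcomp g f) = mcomp (mcomp h g) f;
  mcomp1m : forall (X Y : obj) (f : mor X Y), mcomp (mid Y) f = f;
  mcompm1 : forall (X Y : obj) (f : mor X Y), mcomp f (mid X) = f;
  mcomp_linl : forall (X Y Z : obj) (a : k) (g g' : mor Y Z) (f : mor X Y),
    mcomp (a *: g + g') f = a *: mcomp g f + mcomp g' f;
  mcomp_linr : forall (X Y Z : obj) (a : k) (g : mor Y Z) (f f' : mor X Y),
    mcomp g (a *: f + f') = a *: mcomp g f + mcomp g f'
}.

Arguments mor {k C} X Y : rename.
Arguments mid {k C} X : rename.
Arguments mcomp {k C X Y Z} g f : rename.
Notation "g \oc f" := (mcomp g f) : cat_scope.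

Definition inverse_pair (k : fieldType) (C : linear_category k) (X Y : C)
    (f : mor X Y) (g : mor Y X) : Prop :=
  g \oc f = mid X /\ f \oc g = mid Y.

Definition is_iso (k : fieldType) (C : linear_category k) (X Y : C)
    (f : mor X Y) : Prop :=
  exists g : mor Y X, inverse_pair f g.

Definition isomorphic (k : fieldType) (C : linear_category k) (X Y : C) : Prop :=
  exists f : mor X Y, is_iso f.

Definition is_mono (k : fieldType) (C : linear_category k) (X Y : C)
    (f : mor X Y) : Prop :=
  forall (W : C) (u v : mor W X), f \oc u = f \oc v -> u = v.

Definition is_epi (k : fieldType) (C : linear_category k) (X Y : C)
    (f : mor X Y) : Prop :=
  forall (Z : C) (u v : mor Y Z), u \oc f = v \oc f -> u = v.

Definition is_zero (k : fieldType) (C : linear_category k) (Z : C) : Prop :=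
  forall Y : C, (forall f : mor Z Y, f = 0) /\ (forall f : mor Y Z, f = 0).

Definition is_kernel (k : fieldType) (C : linear_category k) (K X Y : C)
    (i : mor K X) (f : mor X Y) : Prop :=
  f \oc i = 0 /\
  forall (W : C) (u : mor W X), f \oc u = 0 -> exists! v : mor W K, i \oc v = u.

Definition is_cokernel (k : fieldType) (C : linear_category k) (X Y Q : C)
    (p : mor Y Q) (f : mor X Y) : Prop :=
  p \oc f = 0 /\
  forall (Z : C) (u : mor Y Z), u \oc f = 0 -> exists! v : mor Q Z, v \oc p = u.

(* [X] is the direct sum (biproduct) of the [S a]; a zero object for n = 0. *)
Definition is_direct_sum (k : fieldType) (C : linear_category k) (n : nat)
    (S : 'I_n -> C) (X : C) : Prop :=
  exists (i : forall a, mor (S a) X) (p : forall a, mor X (S a)),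
    [/\ forall a, p a \oc i a = mid (S a),
        forall a b, a != b -> p a \oc i b = 0
      & \sum_a (i a \oc p a) = mid X].

Definition abelian_category (k : fieldType) (C : linear_category k) : Prop :=
  (forall (n : nat) (S : 'I_n -> C), exists X, is_direct_sum S X) /\
  (forall (X Y : C) (f : mor X Y), exists (K : C) (i : mor K X), is_kernel i f) /\
  (forall (X Y : C) (f : mor X Y), exists (Q : C) (p : mor Y Q), is_cokernel p f) /\
  (forall (X Y : C) (f : mor X Y), is_mono f ->
     exists (Z : C) (g : mor Y Z), is_kernel f g) /\
  (forall (X Y : C) (f : mor X Y), is_epi f ->
     exists (W : C) (g : mor W X), is_cokernel f g).

Definition simple_object (k : fieldType) (C : linear_category k) (X : C) : Prop :=
  ~ is_zero X /\
  forall (Y : C) (f : mor Y X), is_mono f -> is_zero Y \/ is_iso f.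

Definition semisimple_category (k : fieldType) (C : linear_category k) : Prop :=
  forall X : C, exists (n : nat) (S : 'I_n -> C),
    (forall a, simple_object (S a)) /\ is_direct_sum S X.

Definition simple_representatives (k : fieldType) (C : linear_category k)
    (m : nat) (X : 'I_m -> C) : Prop :=
  [/\ forall i, simple_object (X i),
      forall i j, isomorphic (X i) (X j) -> i = j
    & forall Y : C, simple_object Y -> exists i, isomorphic Y (X i)].

(** * Monoidal and fusion categories *)

Record monoidal_data (k : fieldType) := MonoidalData {
  mlin :> linear_category k;
  tens : mlin -> mlin -> mlin;
  tensh : forall X X' Y Y' : mlin,
    mor X X' -> mor Y Y' -> mor (tens X Y) (tens X' Y');
  tunit : mlin;
  assoc : forall X Y Z : mlin, mor (tens (tens X Y) Z) (tens X (tens Y Z));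
  assocV : forall X Y Z : mlin, mor (tens X (tens Y Z)) (tens (tens X Y) Z);
  lunit : forall X : mlin, mor (tens tunit X) X;
  lunitV : forall X : mlin, mor X (tens tunit X);
  runit : forall X : mlin, mor (tens X tunit) X;
  runitV : forall X : mlin, mor X (tens X tunit)
}.

Arguments tens {k C} X Y : rename.
Arguments tensh {k C X X' Y Y'} f g : rename.
Arguments tunit {k C} : rename.
Arguments assoc {k C} X Y Z : rename.
Arguments assocV {k C} X Y Z : rename.
Arguments lunit {k C} X : rename.
Arguments lunitV {k C} X : rename.
Arguments runit {k C} X : rename.
Arguments runitV {k C} X : rename.
Notation "X \ox Y" := (tens X Y) : cat_scope.
Notation "f \oh g" := (tensh f g) : cat_scope.

Record monoidal_category (k : fieldType) := MonoidalCategory {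
  mdata :> monoidal_data k;
  tensh1 : forall X Y : mdata, mid X \oh mid Y = mid (X \ox Y);
  tensh_comp : forall (X X' X'' Y Y' Y'' : mdata) (f' : mor X' X'')
      (f : mor X X') (g' : mor Y' Y'') (g : mor Y Y'),
    (f' \oc f) \oh (g' \oc g) = (f' \oh g') \oc (f \oh g);
  tensh_linl : forall (X X' Y Y' : mdata) (a : k) (f f' : mor X X') (g : mor Y Y'),
    (a *: f + f') \oh g = a *: (f \oh g) + f' \oh g;
  tensh_linr : forall (X X' Y Y' : mdata) (a : k) (f : mor X X') (g g' : mor Y Y'),
    f \oh (a *: g + g') = a *: (f \oh g) + f \oh g';
  assocP : forall X Y Z : mdata, inverse_pair (assoc X Y Z) (assocV X Y Z);
  lunitP : forall X : mdata, inverse_pair (lunit X) (lunitV X);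
  runitP : forall X : mdata, inverse_pair (runit X) (runitV X);
  assoc_nat : forall (X X' Y Y' Z Z' : mdata)
      (f : mor X X') (g : mor Y Y') (h : mor Z Z'),
    assoc X' Y' Z' \oc ((f \oh g) \oh h) = (f \oh (g \oh h)) \oc assoc X Y Z;
  lunit_nat : forall (X Y : mdata) (f : mor X Y),
    lunit Y \oc (mid tunit \oh f) = f \oc lunit X;
  runit_nat : forall (X Y : mdata) (f : mor X Y),
    runit Y \oc (f \oh mid tunit) = f \oc runit X;
  pentagon : forall W X Y Z : mdata,
    assoc W X (Y \ox Z) \oc assoc (W \ox X) Y Z =
    (mid W \oh assoc X Y Z) \oc assoc W (X \ox Y) Z \oc (assoc W X Y \oh mid Z);
  triangle : forall X Y : mdata,
    (mid X \oh lunit Y) \oc assoc X tunit Y = runit X \oh mid Y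
}.

(* [D] is a left dual of [X], equivalently [X] is a right dual of [D]. *)
Definition is_left_dual (k : fieldType) (C : monoidal_data k) (X D : C)
    (e : mor (D \ox X) tunit) (c : mor tunit (X \ox D)) : Prop :=
  runit X \oc (mid X \oh e) \oc assoc X D X \oc (c \oh mid X) \oc lunitV X
    = mid X /\
  lunit D \oc (e \oh mid D) \oc assocV D X D \oc (mid D \oh c) \oc runitV D
    = mid D.

(* Used over an algebraically closed field k, where the unit axiom says End(1) = k. *)
Record fusion_category (k : fieldType) := FusionCategory {
  fmon :> monoidal_category k;
  ldual : fmon -> fmon;
  ev : forall X : fmon, mor (ldual X \ox X) tunit;
  coev : forall X : fmon, mor tunit (X \ox ldual X);
  left_dualP : forall X : fmon, is_left_dual (ev X) (coev X);
  right_dual_exists : forall X : fmon,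
    exists (D : fmon) (e : mor (X \ox D) tunit) (c : mor tunit (D \ox X)),
      is_left_dual e c;
  fusion_abelian : abelian_category fmon;
  fusion_semisimple : semisimple_category fmon;
  fusion_finite :
    exists (m : nat) (X : 'I_m -> fmon), simple_representatives X;
  fusion_unit : \dim {: mor (tunit : fmon) tunit} = 1%N
}.

Arguments ldual {k C} X : rename.
Arguments ev {k C} X : rename.
Arguments coev {k C} X : rename.

(* The transpose f^* : Y^* -> X^* of f : X -> Y. *)
Definition dualh (k : fieldType) (C : fusion_category k) (X Y : C)
    (f : mor X Y) : mor (ldual Y) (ldual X) :=
  lunit (ldual X) \oc (ev Y \oh mid (ldual X)) \oc assocV (ldual Y) Y (ldual X)
    \oc (mid (ldual Y) \oh (f \oh mid (ldual X)))
    \oc (mid (ldual Y) \oh coev X) \oc runitV (ldual Y).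

(* The scalar a such that f = a *: mid tunit. *)
Definition unit_scalar (k : fieldType) (C : fusion_category k)
    (f : mor (tunit : C) tunit) : k :=
  coord [tuple mid (tunit : C)] ord0 f.

(** * Ribbon and modular categories *)

Record ribbon_data (k : fieldType) := RibbonData {
  rfus :> fusion_category k;
  braid : forall X Y : rfus, mor (X \ox Y) (Y \ox X);
  twist : forall X : rfus, mor X X
}.

Arguments braid {k C} X Y : rename.
Arguments twist {k C} X : rename.

Record ribbon_category (k : fieldType) := RibbonCategory {
  rdata :> ribbon_data k;
  braid_iso : forall X Y : rdata, is_iso (braid X Y);
  braid_nat : forall (X X' Y Y' : rdata) (f : mor X X') (g : mor Y Y'),
    braid X' Y' \oc (f \oh g) = (g \oh f) \oc braid X Y;
  hexagon1 : forall X Y Z : rdata,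
    assoc Y Z X \oc braid X (Y \ox Z) \oc assoc X Y Z =
    (mid Y \oh braid X Z) \oc assoc Y X Z \oc (braid X Y \oh mid Z);
  hexagon2 : forall X Y Z : rdata,
    assocV Z X Y \oc braid (X \ox Y) Z \oc assocV X Y Z =
    (braid X Z \oh mid Y) \oc assocV X Z Y \oc (mid X \oh braid Y Z);
  twist_iso : forall X : rdata, is_iso (twist X);
  twist_nat : forall (X Y : rdata) (f : mor X Y),
    twist Y \oc f = f \oc twist X;
  twist_tens : forall X Y : rdata,
    twist (X \ox Y) = (twist X \oh twist Y) \oc (braid Y X \oc braid X Y);
  twist_dual : forall X : rdata, dualh (twist X) = twist (ldual X)
}.

(* The trace for the spherical structure psi = u theta : X -> X^** where u is
   the Drinfeld isomorphism; ev_{X^*} (u_X (x) id) has been simplified to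
   ev_X c_{X,X^*}. *)
Definition qtrace (k : fieldType) (C : ribbon_category k) (X : C)
    (f : mor X X) : k :=
  unit_scalar
    (ev X \oc braid X (ldual X) \oc ((twist X \oc f) \oh mid (ldual X)) \oc coev X).

Definition Smatrix (k : fieldType) (C : ribbon_category k) (m : nat)
    (X : 'I_m -> C) : 'M[k]_m :=
  \matrix_(i, j) qtrace (braid (X j) (X i) \oc braid (X i) (X j)).

Record modular_category (k : fieldType) := ModularCategory {
  mrib :> ribbon_category k;
  modular_nondegenerate : forall (m : nat) (X : 'I_m -> mrib),
    simple_representatives X -> Smatrix X \in unitmx
}.

(** * The Grothendieck ring *)

(* K(C) (x) A is the free A-module 'rV[A]_m on the classes of the simple
   objects; A = int gives K(C) itself. *)
Definition xcl (A : comNzRingType) (m : nat) (i : 'I_m) : 'rV[A]_m :=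
  delta_mx 0 i.

(* The multiplicity [Y : S] of a simple object S in a decomposition of Y as a
   direct sum of simple objects; it does not depend on the decomposition. *)
Definition multiplicity (k : fieldType) (C : fusion_category k) (S Y : C) : nat :=
  xget 0%N [set c : nat | exists (n : nat) (T : 'I_n -> C),
    [/\ forall a, simple_object (T a), is_direct_sum T Y
      & c = #|[pred a | `[< isomorphic (T a) S >]]| ] ]%classic.

Definition kclass (A : comNzRingType) (k : fieldType) (C : fusion_category k)
    (m : nat) (X : 'I_m -> C) (Y : C) : 'rV[A]_m :=
  \sum_(l < m) (multiplicity (X l) Y)%:R *: xcl A l.

Definition Kone (A : comNzRingType) (k : fieldType) (C : fusion_category k)
    (m : nat) (X : 'I_m -> C) : 'rV[A]_m :=
  kclass A X tunit.

Definition Kmul (A : comNzRingType) (k : fieldType) (C : fusion_category k)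
    (m : nat) (X : 'I_m -> C) (u v : 'rV[A]_m) : 'rV[A]_m :=
  \sum_(i < m) \sum_(j < m) (u 0 i * v 0 j) *: kclass A X (X i \ox X j).

Definition grouplike (k : fieldType) (C : fusion_category k)
    (m : nat) (X : 'I_m -> C) (i : 'I_m) : Prop :=
  Kmul X (xcl int i) (kclass int X (ldual (X i))) = Kone int X.

(* The largest nonnegative real eigenvalue of multiplication by x_i. *)
Definition FPdim (R : realType) (k : fieldType) (C : fusion_category k)
    (m : nat) (X : 'I_m -> C) (i : 'I_m) : R :=
  sup [set r : R | 0 <= r /\ eigenvalue (lin1_mx (Kmul X (xcl R i))) r]%classic.

(** * Characters and the dual hypergroup *)

Notation Kalg R m := 'rV[R[i]]_m.
Notation Kdual R m := 'Hom(Kalg R m, R[i]^o).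

(* The linear form with value [w i] at [x_i]. *)
Definition form_of (R : realType) (m : nat) (w : 'I_m -> R[i]) : Kdual R m :=
  linfun (fun u : Kalg R m => \sum_(i < m) u 0 i * w i : R[i]^o).

Definition is_character (R : realType) (C : fusion_category R[i])
    (m : nat) (X : 'I_m -> C) (mu : Kdual R m) : Prop :=
  mu (Kone _ X) = 1 /\ forall u v : Kalg R m, mu (Kmul X u v) = mu u * mu v.

Definition characters (R : realType) (C : fusion_category R[i])
    (m : nat) (X : 'I_m -> C) : set (Kdual R m) :=
  [set mu | is_character X mu]%classic.

Definition Burnside (R : realType) (C : fusion_category R[i])
    (m : nat) (X : 'I_m -> C) : Prop :=
  forall i : 'I_m,
    (exists mu, is_character X mu /\ mu (xcl _ i) = 0) <-> ~ grouplike X i.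

Definition dimC (R : realType) (C : fusion_category R[i])
    (m : nat) (X : 'I_m -> C) (i : 'I_m) : R[i] :=
  (FPdim R X i)%:C%C.

Definition FPchar (R : realType) (C : fusion_category R[i])
    (m : nat) (X : 'I_m -> C) : Kdual R m :=
  form_of (dimC X).

(* Determined by (f * g)(x_i / d_i) = f(x_i / d_i) g(x_i / d_i). *)
Definition star (R : realType) (C : fusion_category R[i])
    (m : nat) (X : 'I_m -> C) (f g : Kdual R m) : Kdual R m :=
  form_of (fun i => let y := (dimC X i)^-1 *: xcl _ i in
                    dimC X i * (f y * g y)).

Definition sharp (R : realType) (C : fusion_category R[i])
    (m : nat) (X : 'I_m -> C) (mu : Kdual R m) : Kdual R m :=
  form_of (fun i => mu (kclass _ X (ldual (X i)))).

(* Structure constants: coordinates of mu * nu in the basis of characters. *)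
Definition dual_coef (R : realType) (C : fusion_category R[i])
    (m : nat) (X : 'I_m -> C) (mu nu : Kdual R m) : Kdual R m -> R[i] :=
  xget (fun=> 0)
    [set p : Kdual R m -> R[i] |
       star X mu nu = \sum_(ka \in characters X) p ka *: ka]%classic.

Definition dual_grouplike (R : realType) (C : fusion_category R[i])
    (m : nat) (X : 'I_m -> C) (mu : Kdual R m) : Prop :=
  star X mu (sharp X mu) =
    dual_coef X mu (sharp X mu) (FPchar X) *: FPchar X.

Definition dual_Burnside (R : realType) (C : fusion_category R[i])
    (m : nat) (X : 'I_m -> C) : Prop :=
  forall mu : Kdual R m, is_character X mu ->
    ((exists i : 'I_m, mu (xcl _ i) = 0) <-> ~ dual_grouplike X mu).

(* Main.v *)
(** Let [L i j] be the scalar by which the partial trace over [X j] of the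
double braiding acts on [X i]. Then [L i] is a character of the Grothendieck
ring and [S i j = L i j * d i], where [d i] is the quantum dimension; as [S] is
invertible, every character is some [L i] and no [d i] vanishes, and as [S] is
symmetric, [L i j = 0] if and only if [L j i = 0]. Reciprocity of the fusion
coefficients gives [L i (x_j^* ) = conj (L i x_j)]. Hence [x_i] is grouplike iff
[|L j i| = 1] for all [j], and [L j] is grouplike in the dual iff [|L j i| =
FPdim] of [X i] for all [i]. Moreover [FPdim = L p] for some [p], by a Perron-
Frobenius argument.

If Burnside holds and [L j] has no zeros, then neither has [L i j] for fixed
[j], so [x_j], and likewise [x_p], is grouplike; thus [|L j i| = |d i / d j|]
and [|L p i| = |d i / d p|], and evaluating at the unit shows that these agree.
Conversely, if dual-Burnside holds and [x_i] has no zeros, then [L i] is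
grouplike in the dual, and so is the unit character [L o]; thus [|L i k| = |L o
k|], so that [|L k i|] does not depend on [k]. Hence [x_i x_i^*] is a multiple
of the unit, and this multiple is 1 because the unit occurs once in it. *)

Require Import Defs.
From HB Require Import structures.
From mathcomp Require Import all_boot all_order all_algebra.
From mathcomp Require Import all_classical all_reals.
From mathcomp Require Import complex.

Set Implicit Arguments.
Unset Strict Implicit.
Unset Printing Implicit Defensive.

Import Order.TTheory GRing.Theory Num.Theory.
Local Open Scope ring_scope.
Local Open Scope cat_scope.

Reserved Notation "X \lw f" (at level 45, right associativity).
Reserved Notation "f \rw W" (at level 45, right associativity).

(** * Linear and monoidal categories *)

Section LinearCategory.
Variables (k : fieldType) (C : linear_category k).
Implicit Types X Y Z W : C.

Lemma comp_focus2 X Y Z W (f : mor Y Z) (g : mor X Y) (r : mor X Z)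
    (l : mor Z W) : f \oc g = r -> l \oc f \oc g = l \oc r.
Proof. by move=> <-; rewrite mcompA. Qed.

Lemma comp_focus3 X Y Z T W (f : mor Y Z) (g : mor X Y) (h : mor T X)
    (r : mor T Z) (l : mor Z W) :
  f \oc g \oc h = r -> l \oc f \oc g \oc h = l \oc r.
Proof. by move=> <-; rewrite !mcompA. Qed.

Lemma comp_focus4 X Y Z T U W (f : mor Y Z) (g : mor X Y) (h : mor T X)
    (i : mor U T) (r : mor U Z) (l : mor Z W) :
  f \oc g \oc h \oc i = r -> l \oc f \oc g \oc h \oc i = l \oc r.
Proof. by move=> <-; rewrite !mcompA. Qed.

Lemma comp_focus5 X Y Z T U V W (f : mor Y Z) (g : mor X Y) (h : mor T X)
    (i : mor U T) (j : mor V U) (r : mor V Z) (l : mor Z W) :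
  f \oc g \oc h \oc i \oc j = r ->
  l \oc f \oc g \oc h \oc i \oc j = l \oc r.
Proof. by move=> <-; rewrite !mcompA. Qed.

Lemma mcompDl X Y Z (g g' : mor Y Z) (f : mor X Y) :
  (g + g') \oc f = (g \oc f) + (g' \oc f).
Proof. by have := mcomp_linl 1 g g' f; rewrite !scale1r. Qed.

Lemma mcompDr X Y Z (g : mor Y Z) (f f' : mor X Y) :
  g \oc (f + f') = (g \oc f) + (g \oc f').
Proof. by have := mcomp_linr 1 g f f'; rewrite !scale1r. Qed.

Lemma mcomp0l X Y Z (f : mor X Y) : (0 : mor Y Z) \oc f = 0.
Proof. by apply: (addrI (0 \oc f)); rewrite -mcompDl !addr0. Qed.

Lemma mcomp0r X Y Z (g : mor Y Z) : g \oc (0 : mor X Y) = 0.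
Proof. by apply: (addrI (g \oc 0)); rewrite -mcompDr !addr0. Qed.

Lemma mcompZl X Y Z a (g : mor Y Z) (f : mor X Y) :
  (a *: g) \oc f = a *: (g \oc f).
Proof. by have := mcomp_linl a g 0 f; rewrite mcomp0l !addr0. Qed.

Lemma mcompZr X Y Z a (g : mor Y Z) (f : mor X Y) :
  g \oc (a *: f) = a *: (g \oc f).
Proof. by have := mcomp_linr a g f 0; rewrite mcomp0r !addr0. Qed.

Lemma mcomp_suml X Y Z (I : finType) (P : pred I) (g : I -> mor Y Z)
    (f : mor X Y) : (\sum_(i | P i) g i) \oc f = \sum_(i | P i) (g i \oc f).
Proof.
apply: (big_morph (fun u => u \oc f)) => [u v|]; last exact: mcomp0l.
exact: mcompDl.
Qed.

Lemma mcomp_sumr X Y Z (I : finType) (P : pred I) (g : mor Y Z)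
    (f : I -> mor X Y) : g \oc (\sum_(i | P i) f i) = \sum_(i | P i) (g \oc f i).
Proof.
apply: (big_morph (fun u => g \oc u)) => [u v|]; last exact: mcomp0r.
exact: mcompDr.
Qed.

End LinearCategory.

(* Rewrites with an equation between composites anywhere in a composition
   chain, up to associativity. *)
Ltac crw H :=
  rewrite ?mcompA;
  first [ rewrite H | rewrite (comp_focus2 _ H) | rewrite (comp_focus3 _ H)
        | rewrite (comp_focus4 _ H) | rewrite (comp_focus5 _ H) ];
  rewrite ?mcompA ?mcomp1m ?mcompm1.

(** * Whiskering, coherence and the word calculus of a monoidal category *)

Section Monoidal.
Variables (k : fieldType) (C : monoidal_category k).
Implicit Types X Y Z W A B D : C.

Definition lwhisk X Y Z (f : mor Y Z) : mor (X \ox Y) (X \ox Z) := mid X \oh f.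
Definition rwhisk X Y (f : mor X Y) W : mor (X \ox W) (Y \ox W) := f \oh mid W.
Local Notation "X \lw f" := (lwhisk X f).
Local Notation "f \rw W" := (rwhisk f W).

Lemma lwC X Y Z W (f : mor Z W) (g : mor Y Z) :
  X \lw f \oc X \lw g = X \lw (f \oc g).
Proof. by rewrite /lwhisk -tensh_comp mcomp1m. Qed.

Lemma lw1 X Y : X \lw mid Y = mid (X \ox Y).
Proof. exact: tensh1. Qed.

Lemma lw2 X Y Z T (f : mor Z T) (g : mor Y Z) r :
  f \oc g = r -> X \lw f \oc X \lw g = X \lw r.
Proof. by move=> <-; rewrite lwC. Qed.

Lemma lw3 X Y Z T U (f : mor Z T) (g : mor Y Z) (h : mor U Y) r :
  f \oc g \oc h = r -> X \lw f \oc X \lw g \oc X \lw h = X \lw r.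
Proof. by move=> <-; rewrite !lwC. Qed.

Lemma rwC X Y Z (f : mor Y Z) (g : mor X Y) W :
  f \rw W \oc g \rw W = (f \oc g) \rw W.
Proof. by rewrite /rwhisk -tensh_comp mcomp1m. Qed.

Lemma rw1 X W : mid X \rw W = mid (X \ox W).
Proof. exact: tensh1. Qed.

Lemma lw_rw X X' W W' (f : mor X X') (g : mor W W') :
  X' \lw g \oc f \rw W = f \rw W' \oc X \lw g.
Proof. by rewrite /lwhisk /rwhisk -!tensh_comp !mcomp1m !mcompm1. Qed.

Lemma tenshDr X X' Y Y' (f : mor X X') (g g' : mor Y Y') :
  f \oh (g + g') = f \oh g + f \oh g'.
Proof. by have := tensh_linr 1 f g g'; rewrite !scale1r. Qed.

Lemma tenshDl X X' Y Y' (f f' : mor X X') (g : mor Y Y') :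
  (f + f') \oh g = f \oh g + f' \oh g.
Proof. by have := tensh_linl 1 f f' g; rewrite !scale1r. Qed.

Lemma tensh0r X X' Y Y' (f : mor X X') : f \oh (0 : mor Y Y') = 0.
Proof. by apply: (addrI (f \oh 0)); rewrite -tenshDr !addr0. Qed.

Lemma tensh0l X X' Y Y' (f : mor Y Y') : (0 : mor X X') \oh f = 0.
Proof. by apply: (addrI (0 \oh f)); rewrite -tenshDl !addr0. Qed.

Lemma tenshZr X X' Y Y' a (f : mor X X') (g : mor Y Y') :
  f \oh (a *: g) = a *: (f \oh g).
Proof. by have := tensh_linr a f g 0; rewrite tensh0r !addr0. Qed.

Lemma tenshZl X X' Y Y' a (f : mor X X') (g : mor Y Y') :
  (a *: f) \oh g = a *: (f \oh g).
Proof. by have := tensh_linl a f 0 g; rewrite tensh0l !addr0. Qed.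

Lemma tensh_sumr X X' Y Y' (I : finType) (P : pred I) (f : mor X X')
    (g : I -> mor Y Y') :
  f \oh (\sum_(i | P i) g i) = \sum_(i | P i) (f \oh g i).
Proof.
apply: (big_morph (fun u => f \oh u)) => [u v|]; last exact: tensh0r.
exact: tenshDr.
Qed.

Lemma tensh_suml X X' Y Y' (I : finType) (P : pred I) (f : I -> mor X X')
    (g : mor Y Y') :
  (\sum_(i | P i) f i) \oh g = \sum_(i | P i) (f i \oh g).
Proof.
apply: (big_morph (fun u => u \oh g)) => [u v|]; last exact: tensh0l.
exact: tenshDl.
Qed.

Lemma lwZ X Y Z a (f : mor Y Z) : X \lw (a *: f) = a *: (X \lw f).
Proof. exact: tenshZr. Qed.

Lemma assocK X Y Z : assocV X Y Z \oc assoc X Y Z = mid _.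
Proof. by case: (assocP X Y Z). Qed.
Lemma assocVK X Y Z : assoc X Y Z \oc assocV X Y Z = mid _.
Proof. by case: (assocP X Y Z). Qed.
Lemma lunitK X : lunitV X \oc lunit X = mid _.
Proof. by case: (lunitP X). Qed.
Lemma lunitVK X : lunit X \oc lunitV X = mid _.
Proof. by case: (lunitP X). Qed.
Lemma runitK X : runitV X \oc runit X = mid _.
Proof. by case: (runitP X). Qed.
Lemma runitVK X : runit X \oc runitV X = mid _.
Proof. by case: (runitP X). Qed.

Lemma assoc_rw X X' Y W (f : mor X X') :
  assoc X' Y W \oc (f \rw Y) \rw W = f \rw (Y \ox W) \oc assoc X Y W.
Proof. by rewrite /rwhisk assoc_nat tensh1. Qed.
Lemma assoc_mw X Y Y' W (f : mor Y Y') :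
  assoc X Y' W \oc (X \lw f) \rw W = X \lw (f \rw W) \oc assoc X Y W.
Proof. by rewrite /rwhisk assoc_nat. Qed.
Lemma assoc_lw X Y W W' (f : mor W W') :
  assoc X Y W' \oc (X \ox Y) \lw f = X \lw (Y \lw f) \oc assoc X Y W.
Proof. by rewrite /lwhisk -tensh1 assoc_nat. Qed.

Lemma cancel_rl X Y Z W (a : mor X Y) (a' : mor Y X) (b : mor Z W)
    (b' : mor W Z) (f : mor X Z) (g : mor Y W) :
  a \oc a' = mid _ -> b' \oc b = mid _ -> g \oc a = b \oc f ->
  b' \oc g = f \oc a'.
Proof.
move=> aK bK e.
by rewrite -[LHS]mcompm1 -aK !mcompA -(mcompA b' g) e mcompA bK mcomp1m.
Qed.

Lemma cancel_epi X Y Z (a : mor X Y) (a' : mor Y X) (f g : mor Y Z) :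
  a \oc a' = mid _ -> f \oc a = g \oc a -> f = g.
Proof. by move=> aa e; rewrite -[f]mcompm1 -[g]mcompm1 -aa !mcompA e. Qed.

Lemma cancel_mono X Y Z (a : mor X Y) (a' : mor Y X) (f g : mor Z X) :
  a' \oc a = mid _ -> a \oc f = a \oc g -> f = g.
Proof. by move=> aa e; rewrite -[f]mcomp1m -[g]mcomp1m -aa -!mcompA e. Qed.

Lemma assocV_lw X Y W W' (f : mor W W') :
  assocV X Y W' \oc X \lw (Y \lw f) = (X \ox Y) \lw f \oc assocV X Y W.
Proof.
exact: cancel_rl (assocVK _ _ _) (assocK _ _ _) (esym (assoc_lw _ _ f)).
Qed.
Lemma lunit_lw X Y (f : mor X Y) : lunit Y \oc tunit \lw f = f \oc lunit X.
Proof. exact: lunit_nat. Qed.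
Lemma lunitV_lw X Y (f : mor X Y) : lunitV Y \oc f = tunit \lw f \oc lunitV X.
Proof.
exact: cancel_rl (lunitVK _) (lunitK _) (esym (lunit_lw f)).
Qed.

Lemma pentagon_w W X Y Z :
  assoc W X (Y \ox Z) \oc assoc (W \ox X) Y Z =
  W \lw assoc X Y Z \oc assoc W (X \ox Y) Z \oc assoc W X Y \rw Z.
Proof. exact: pentagon. Qed.

Lemma triangle_w X Y :
  X \lw lunit Y \oc assoc X tunit Y = runit X \rw Y.
Proof. exact: triangle. Qed.

(** Naturality and invertibility of [lunit] recover a morphism from its whiskering by the unit. *)
Lemma tunit_lw_inj X Y (f g : mor X Y) : tunit \lw f = tunit \lw g -> f = g.
Proof.
move=> e; rewrite -[f]mcompm1 -[g]mcompm1 -(lunitVK X) !mcompA.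
by rewrite -!lunit_lw e.
Qed.

(* Kelly's coherence lemma. *)
Lemma lunit_tens X Y : lunit (X \ox Y) \oc assoc tunit X Y = lunit X \rw Y.
Proof.
apply: tunit_lw_inj.
have iso : assoc tunit (tunit \ox X) Y \oc assoc tunit tunit X \rw Y \oc
  (assocV tunit tunit X \rw Y \oc assocV tunit (tunit \ox X) Y) = mid _.
  by crw (rwC (assoc tunit tunit X) (assocV tunit tunit X) Y);
    rewrite assocVK rw1 mcompm1 assocVK.
apply: cancel_epi iso _; rewrite !mcompA -lwC.
crw (esym (pentagon_w tunit tunit X Y)).
crw (triangle_w tunit (X \ox Y)); crw (esym (assoc_rw X Y (runit tunit))).
rewrite -triangle_w -rwC; crw (assoc_mw tunit Y (lunit X)).
by [].
Qed.

Lemma lunitV_tens X Y :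
  assoc tunit X Y \oc lunitV X \rw Y = lunitV (X \ox Y).
Proof.
rewrite -[LHS]mcomp1m -(lunitK (X \ox Y)) -mcompA.
by crw (lunit_tens X Y); crw (rwC (lunit X) (lunitV X) Y);
  rewrite lunitVK rw1 mcompm1.
Qed.

(* To avoid coherence isomorphisms, a tensor word X1 ... Xn is represented by the
   functor W |-> X1 (... (Xn W)), and a morphism between words by the natural
   family that it induces.  The suffixes count input and output letters. *)
Definition w22 A B X Y (g : mor (A \ox B) (X \ox Y)) W :
    mor (A \ox (B \ox W)) (X \ox (Y \ox W)) :=
  locked (assoc X Y W \oc g \rw W \oc assocV A B W).

Definition w02 X Y (g : mor tunit (X \ox Y)) W : mor W (X \ox (Y \ox W)) :=
  locked (assoc X Y W \oc g \rw W \oc lunitV W).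

Definition w20 A B (g : mor (A \ox B) tunit) W : mor (A \ox (B \ox W)) W :=
  locked (lunit W \oc g \rw W \oc assocV A B W).

Lemma w22E A B X Y (g : mor (A \ox B) (X \ox Y)) W :
  w22 g W = assoc X Y W \oc g \rw W \oc assocV A B W.
Proof. by rewrite /w22 -lock. Qed.

Lemma w02E X Y (g : mor tunit (X \ox Y)) W :
  w02 g W = assoc X Y W \oc g \rw W \oc lunitV W.
Proof. by rewrite /w02 -lock. Qed.

Lemma w20E A B (g : mor (A \ox B) tunit) W :
  w20 g W = lunit W \oc g \rw W \oc assocV A B W.
Proof. by rewrite /w20 -lock. Qed.

Lemma w22C A B X Y Z T (g : mor (X \ox Y) (Z \ox T))
    (h : mor (A \ox B) (X \ox Y)) W :
  w22 g W \oc w22 h W = w22 (g \oc h) W.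
Proof. by rewrite !w22E -rwC; crw (assocK X Y W). Qed.

Lemma w20_22 X Y Z T (g : mor (Z \ox T) tunit)
    (h : mor (X \ox Y) (Z \ox T)) W :
  w20 g W \oc w22 h W = w20 (g \oc h) W.
Proof. by rewrite !w22E !w20E -rwC; crw (assocK Z T W). Qed.

Lemma w20_02 X Y (g : mor (X \ox Y) tunit) (h : mor tunit (X \ox Y)) W :
  w20 g W \oc w02 h W = lunit W \oc (g \oc h) \rw W \oc lunitV W.
Proof. by rewrite !w02E !w20E -rwC; crw (assocK X Y W). Qed.

Lemma w22_1 X Y W : w22 (mid (X \ox Y)) W = mid _.
Proof. by rewrite !w22E rw1 mcompm1 assocVK. Qed.

Lemma w22_rw X X' Y W (f : mor X X') : w22 (f \rw Y) W = f \rw (Y \ox W).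
Proof. by rewrite !w22E assoc_rw -mcompA assocVK mcompm1. Qed.

Lemma w22_lw X Y Y' W (f : mor Y Y') : w22 (X \lw f) W = X \lw (f \rw W).
Proof. by rewrite !w22E assoc_mw -mcompA assocVK mcompm1. Qed.

Lemma w22N A B X Y (g : mor (A \ox B) (X \ox Y)) W W' (f : mor W W') :
  w22 g W' \oc A \lw (B \lw f) = X \lw (Y \lw f) \oc w22 g W.
Proof.
rewrite !w22E; crw (assocV_lw A B f); crw (esym (lw_rw g f)).
by crw (assoc_lw X Y f).
Qed.

Lemma w02N X Y (g : mor tunit (X \ox Y)) W W' (f : mor W W') :
  w02 g W' \oc f = X \lw (Y \lw f) \oc w02 g W.
Proof.
rewrite !w02E; crw (lunitV_lw f); crw (esym (lw_rw g f)).
by crw (assoc_lw X Y f).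
Qed.

Lemma w20N A B (g : mor (A \ox B) tunit) W W' (f : mor W W') :
  w20 g W' \oc A \lw (B \lw f) = f \oc w20 g W.
Proof.
rewrite !w20E; crw (assocV_lw A B f); crw (esym (lw_rw g f)).
by crw (lunit_lw f).
Qed.

Lemma pentagon_mid W X Y Z :
  assoc W (X \ox Y) Z \oc assoc W X Y \rw Z =
  W \lw assocV X Y Z \oc assoc W X (Y \ox Z) \oc assoc (W \ox X) Y Z.
Proof. by crw (pentagon_w W X Y Z); rewrite lwC assocK lw1 mcomp1m. Qed.

Lemma pentagonV_mid W X Y Z :
  assoc (W \ox X) Y Z \oc assocV W X Y \rw Z =
  assocV W X (Y \ox Z) \oc W \lw assoc X Y Z \oc assoc W (X \ox Y) Z.
Proof.
apply: (@cancel_mono _ _ _ (assoc W X (Y \ox Z)) (assocV W X (Y \ox Z))).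
  exact: assocK.
crw (pentagon_w W X Y Z); rewrite assocVK mcomp1m -!mcompA rwC assocVK.
by rewrite rw1 mcompm1.
Qed.

(** The first duality identity whiskered by [W]; pentagon, triangle and [lunitV_tens] absorb the
    coherence maps. *)
Lemma zigzag1 X D (e : mor (D \ox X) tunit) (c : mor tunit (X \ox D)) W :
  is_left_dual e c -> X \lw w20 e W \oc w02 c (X \ox W) = mid _.
Proof.
case=> z _; move: (congr1 (fun f => rwhisk f W) z) => /=.
rewrite rw1 => <-; rewrite -!rwC -triangle_w !w20E !w02E -!lwC.
crw (assoc_mw X W e); crw (pentagon_mid X D X W).
by crw (assoc_rw X W c); crw (lunitV_tens X W).
Qed.

Lemma assoc_runitV X W :
  assoc X tunit W \oc runitV X \rw W = X \lw lunitV W.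
Proof.
apply: (@cancel_mono _ _ _ (X \lw lunit W) (X \lw lunitV W)).
  by rewrite lwC lunitK lw1.
by crw (triangle_w X W); rewrite rwC lwC runitVK lunitVK rw1 lw1.
Qed.

Lemma zigzag2 X D (e : mor (D \ox X) tunit) (c : mor tunit (X \ox D)) W :
  is_left_dual e c -> w20 e (D \ox W) \oc D \lw w02 c W = mid _.
Proof.
case=> _ z; move: (congr1 (fun f => rwhisk f W) z) => /=.
rewrite rw1 => <-; rewrite -!rwC !w20E !w02E -!lwC.
rewrite -lunit_tens; crw (assoc_rw D W e).
by crw (pentagonV_mid D X D W); crw (assoc_mw D W c); crw (assoc_runitV D W).
Qed.

End Monoidal.
Notation "X \lw f" := (lwhisk X f) : cat_scope.
Notation "f \rw W" := (rwhisk f W) : cat_scope.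

Ltac mrw H := crw H; rewrite -?lwC ?lw1 ?mcompA ?mcomp1m ?mcompm1.

(** * Braided words and their closures *)

Section Ribbon.
Variables (k : fieldType) (C : ribbon_category k).
Implicit Types X Y Z W A B : C.

Definition braid_tail X Y W : mor (X \ox (Y \ox W)) (Y \ox (X \ox W)) :=
  w22 (braid X Y) W.
Local Notation b := braid_tail.

(** This is [hexagon1] whiskered by [W], the pentagon clearing the associators between the
    letters. *)
Lemma hexR Z X Y W :
  assoc X Y (Z \ox W) \oc b Z (X \ox Y) W =
  X \lw b Z Y W \oc b Z X (Y \ox W) \oc Z \lw assoc X Y W.
Proof.
apply: (@cancel_epi _ _ _ _ _ (assoc Z (X \ox Y) W \oc assoc Z X Y \rw W)
  (assocV Z X Y \rw W \oc assocV Z (X \ox Y) W)).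
  crw (rwC (assoc Z X Y) (assocV Z X Y) W).
  by rewrite assocVK rw1 mcompm1 assocVK.
crw (esym (pentagon_w Z X Y W)); rewrite /b !w22E.
crw (assocK Z (X \ox Y) W); crw (pentagon_w X Y Z W).
crw (rwC (assoc X Y Z) (braid Z (X \ox Y)) W).
crw (rwC (assoc X Y Z \oc braid Z (X \ox Y)) (assoc Z X Y) W).
rewrite (hexagon1 Z X Y) -!/(lwhisk _ _) -!/(rwhisk _ _).
crw (assocK Z X (Y \ox W)); rewrite -!rwC -!lwC.
crw (assoc_mw X W (braid Z Y)); crw (pentagon_mid X Z Y W).
by crw (assoc_rw Y W (braid Z X)).
Qed.

Lemma hexL X Y Z W :
  Z \lw assoc X Y W \oc b (X \ox Y) Z W =
  b X Z (Y \ox W) \oc X \lw b Y Z W \oc assoc X Y (Z \ox W).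
Proof.
apply: (@cancel_epi _ _ _ _ _ (assoc (X \ox Y) Z W \oc assocV X Y Z \rw W)
  (assoc X Y Z \rw W \oc assocV (X \ox Y) Z W)).
  crw (rwC (assocV X Y Z) (assoc X Y Z) W).
  by rewrite assocK rw1 mcompm1 assocVK.
rewrite /b !w22E; crw (assocK (X \ox Y) Z W).
have E : Z \lw assoc X Y W \oc assoc Z (X \ox Y) W =
   assoc Z X (Y \ox W) \oc assoc (Z \ox X) Y W \oc assocV Z X Y \rw W.
  rewrite -mcompA pentagonV_mid !mcompA.
  by rewrite assocVK mcomp1m.
crw E; crw (rwC (assocV Z X Y) (braid (X \ox Y) Z) W).
crw (rwC (assocV Z X Y \oc braid (X \ox Y) Z) (assocV X Y Z) W).
rewrite (hexagon2 X Y Z) -!/(lwhisk _ _) -!/(rwhisk _ _) -!rwC -!lwC.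
crw (assoc_rw Y W (braid X Z)); crw (pentagonV_mid X Z Y W).
crw (assoc_mw X W (braid Y Z)).
crw (pentagon_w X Y Z W).
crw (lwC X (assocV Y Z W) (assoc Y Z W)); rewrite assocK lw1 mcompm1.
crw (rwC (assoc X Y Z) (assocV X Y Z) W).
by rewrite assocVK rw1 mcompm1.
Qed.

Lemma bN X Y W W' (f : mor W W') :
  b X Y W' \oc X \lw (Y \lw f) = Y \lw (X \lw f) \oc b X Y W.
Proof. exact: w22N. Qed.

Lemma b_rw X X' Y W (f : mor X X') :
  b X' Y W \oc f \rw (Y \ox W) = Y \lw (f \rw W) \oc b X Y W.
Proof. by rewrite /b -w22_rw w22C braid_nat -w22C w22_lw. Qed.

Lemma b_lw X Y Y' W (f : mor Y Y') :
  b X Y' W \oc X \lw (f \rw W) = f \rw (X \ox W) \oc b X Y W.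
Proof. by rewrite /b -w22_lw w22C braid_nat -w22C w22_rw. Qed.

Lemma b_epi X Y W V (f g : mor (Y \ox (X \ox W)) V) :
  f \oc b X Y W = g \oc b X Y W -> f = g.
Proof.
have [c [_ c2]] := braid_iso X Y.
apply: (@cancel_epi _ _ _ _ _ _ (w22 c W)).
by rewrite /b w22C c2 w22_1.
Qed.

(** The hexagon for [tunit \ox tunit], with naturality along [runit tunit], writes one braiding past
    the unit as two of them; invertibility cancels one. *)
Lemma b_unit Z W : lunit (Z \ox W) \oc b Z tunit W = Z \lw lunit W.
Proof.
apply: tunit_lw_inj.
apply: (@b_epi Z tunit (tunit \ox W)).
rewrite -bN -lwC.
have E : tunit \lw lunit W \oc assoc tunit tunit W = runit tunit \rw W.
  exact: triangle.
have E' : tunit \lw lunit W = runit tunit \rw W \oc assocV tunit tunit W.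
  by rewrite -E -mcompA assocVK mcompm1.
rewrite [tunit \lw lunit W]E' -lwC; crw (b_lw Z W (runit (tunit : C))).
have E2 : tunit \lw lunit (Z \ox W) \oc assoc tunit tunit (Z \ox W) =
   runit tunit \rw (Z \ox W).
  exact: triangle.
rewrite -E2; crw (hexR Z tunit tunit W).
by crw (lwC Z (assoc tunit tunit W) (assocV tunit tunit W));
  rewrite assocVK lw1 mcompm1.
Qed.

Lemma b_unitV Z W : b Z tunit W \oc Z \lw lunitV W = lunitV (Z \ox W).
Proof.
apply: (@cancel_mono _ _ _ _ _ (lunit (Z \ox W)) (lunitV (Z \ox W))).
  exact: lunitK.
by crw (b_unit Z W); rewrite lwC !lunitVK lw1.
Qed.

Lemma hexRV Z X Y W :
  b Z (X \ox Y) W \oc Z \lw assocV X Y W =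
  assocV X Y (Z \ox W) \oc X \lw b Z Y W \oc b Z X (Y \ox W).
Proof.
apply: (@cancel_mono _ _ _ _ _ (assoc X Y (Z \ox W)) (assocV X Y (Z \ox W))).
  exact: assocK.
crw (assocVK X Y (Z \ox W)); crw (hexR Z X Y W).
by crw (lwC Z (assoc X Y W) (assocV X Y W)); rewrite assocVK lw1 mcompm1.
Qed.

Lemma hexLV X Y Z W :
  b (X \ox Y) Z W \oc assocV X Y (Z \ox W) =
  Z \lw assocV X Y W \oc b X Z (Y \ox W) \oc X \lw b Y Z W.
Proof.
apply: (@cancel_mono _ _ _ _ _ (Z \lw assoc X Y W) (Z \lw assocV X Y W)).
  by rewrite lwC assocK lw1.
crw (lwC Z (assoc X Y W) (assocV X Y W)); rewrite assocVK lw1 mcomp1m.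
by crw (hexL X Y Z W); crw (assocVK X Y (Z \ox W)).
Qed.

Lemma slide22 Z A B X Y (g : mor (A \ox B) (X \ox Y)) W :
  X \lw b Z Y W \oc b Z X (Y \ox W) \oc Z \lw w22 g W =
  w22 g (Z \ox W) \oc A \lw b Z B W \oc b Z A (B \ox W).
Proof.
rewrite w22E [in RHS]w22E -!lwC; crw (esym (hexR Z X Y W)).
by crw (b_lw Z W g); crw (hexRV Z A B W).
Qed.

Lemma slide02 Z X Y (g : mor tunit (X \ox Y)) W :
  X \lw b Z Y W \oc b Z X (Y \ox W) \oc Z \lw w02 g W = w02 g (Z \ox W).
Proof.
rewrite !w02E -!lwC; crw (esym (hexR Z X Y W)).
by crw (b_lw Z W g); crw (b_unitV Z W).
Qed.

Lemma slide20 Z A B (g : mor (A \ox B) tunit) W :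
  w20 g (Z \ox W) \oc A \lw b Z B W \oc b Z A (B \ox W) = Z \lw w20 g W.
Proof.
rewrite !w20E -!lwC; crw (esym (hexRV Z A B W)); crw (esym (b_lw Z W g)).
by crw (b_unit Z W).
Qed.

End Ribbon.

(** * Duality in words and the closing of strands *)

Section Duals.
Variables (k : fieldType) (C : ribbon_category k).
Implicit Types X Y Z W A B : C.
Local Notation b := (@braid_tail k C).
Local Notation "X ^d" := (ldual (X : C) : C).

Definition eta X W : mor W (X \ox (X^d \ox W)) := w02 (coev X) W.
Definition eps X W : mor (X^d \ox (X \ox W)) W := w20 (ev X) W.
Definition sigma X W : mor (X \ox (X^d \ox W)) W :=
  locked (eps X W \oc b X X^d W).
(** The evaluation of $X \otimes X^*$ at the head of a word, made from [ev] by a braiding and a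
    twist; the twist is what makes it multiplicative in [tau_tens]. *)
Definition tau X W : mor (X \ox (X^d \ox W)) W :=
  locked (sigma X W \oc twist X \rw (X^d \ox W)).

Lemma sigmaE X W : sigma X W = eps X W \oc b X X^d W.
Proof. by rewrite /sigma -lock. Qed.

Lemma tauE X W : tau X W = sigma X W \oc twist X \rw (X^d \ox W).
Proof. by rewrite /tau -lock. Qed.

Lemma etaN X W W' (f : mor W W') :
  eta X W' \oc f = X \lw (X^d \lw f) \oc eta X W.
Proof. exact: w02N. Qed.

Lemma epsN X W W' (f : mor W W') :
  eps X W' \oc X^d \lw (X \lw f) = f \oc eps X W.
Proof. exact: w20N. Qed.

Lemma sigmaN X W W' (f : mor W W') :
  sigma X W' \oc X \lw (X^d \lw f) = f \oc sigma X W.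
Proof. by rewrite !sigmaE; crw (bN X X^d f); crw (epsN X f). Qed.

Lemma tauN X W W' (f : mor W W') :
  tau X W' \oc X \lw (X^d \lw f) = f \oc tau X W.
Proof.
by rewrite !tauE; crw (esym (lw_rw (twist X) (X^d \lw f))); crw (sigmaN X f).
Qed.

Lemma zig1 X W : X \lw eps X W \oc eta X (X \ox W) = mid _.
Proof. exact/zigzag1/left_dualP. Qed.

Lemma zig2 X W : eps X (X^d \ox W) \oc X^d \lw eta X W = mid _.
Proof. exact/zigzag2/left_dualP. Qed.

Lemma slide_eta Z X W :
  X \lw b Z X^d W \oc b Z X (X^d \ox W) \oc Z \lw eta X W = eta X (Z \ox W).
Proof. exact: slide02. Qed.

Lemma slide_eps Z X W :
  eps X (Z \ox W) \oc X^d \lw b Z X W \oc b Z X^d (X \ox W) = Z \lw eps X W.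
Proof. exact: slide20. Qed.

(** The Yang-Baxter equation, as the case of a braiding in [slide22]. *)
Lemma slide_b Z A B W :
  B \lw b Z A W \oc b Z B (A \ox W) \oc Z \lw b A B W =
  b A B (Z \ox W) \oc A \lw b Z B W \oc b Z A (B \ox W).
Proof. exact: slide22. Qed.

Lemma slide_sigma Z X W :
  sigma X (Z \ox W) \oc X \lw b Z X^d W \oc b Z X (X^d \ox W) =
  Z \lw sigma X W.
Proof.
rewrite !sigmaE -lwC; crw (esym (slide_b Z X X^d W)).
by crw (slide_eps Z X W).
Qed.

(* Both sides close the strands X and Y; the left-hand side is the closure for
   the tensor product, and the double braiding accounts for its twist. *)
Lemma sigma_tens X Y W :
  eps Y W \oc Y^d \lw eps X (Y \ox W) \oc Y^d \lw b X X^d (Y \ox W) \oc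
  b X Y^d (X^d \ox (Y \ox W)) \oc X \lw (Y^d \lw b Y X^d W) \oc
  X \lw b Y Y^d (X^d \ox W) \oc b Y X (Y^d \ox (X^d \ox W)) \oc
  b X Y (Y^d \ox (X^d \ox W)) =
  sigma X W \oc X \lw sigma Y (X^d \ox W).
Proof.
crw (bN X Y^d (b Y X^d W)).
crw (esym (slide_b Y X Y^d (X^d \ox W))).
crw (lw3 Y^d (esym (slide_b Y X X^d W))); rewrite -!lwC.
crw (lw3 Y^d (slide_eps Y X W)).
rewrite -slide_sigma; crw (esym (sigmaN Y (sigma X W))).
rewrite !sigmaE -!lwC.
by crw (bN Y Y^d (eps X W)); crw (bN Y Y^d (b X X^d W)).
Qed.

End Duals.

(** * Duals and closures of tensor products *)

Section TensorDual.
Variables (k : fieldType) (C : ribbon_category k).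
Implicit Types X Y Z W A B : C.
Local Notation b := (@braid_tail k C).
Local Notation "X ^d" := (ldual (X : C) : C).

(* The canonical comparison Y^* X^* -> (X Y)^*. *)
Definition mate_tens X Y W : mor (Y^d \ox (X^d \ox W)) ((X \ox Y)^d \ox W) :=
  locked (eps Y _ \oc Y^d \lw eps X _ \oc
    Y^d \lw (X^d \lw (assoc X Y _ \oc eta (X \ox Y) W))).
Local Notation v := mate_tens.

Lemma mate_tensE X Y W : v X Y W = eps Y _ \oc Y^d \lw eps X _ \oc
    Y^d \lw (X^d \lw (assoc X Y _ \oc eta (X \ox Y) W)).
Proof. by rewrite /v -lock. Qed.

(** The two evaluations inside [mate_tens] cancel against the nested coevaluations of [Y] and
    [X]. *)
Lemma eta_tens X Y W :
  X \lw (Y \lw v X Y W) \oc X \lw eta Y (X^d \ox W) \oc eta X W =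
  assoc X Y _ \oc eta (X \ox Y) W.
Proof.
rewrite mate_tensE.
move: (assoc X Y _ \oc _) => r. rewrite -?lwC.
crw (lw2 X (esym (etaN Y (X^d \lw r)))); rewrite -?lwC.
crw (lw2 X (esym (etaN Y (eps X (Y \ox ((X \ox Y)^d \ox W)))))); rewrite -?lwC.
crw (lw2 X (zig1 Y ((X \ox Y)^d \ox W))); rewrite lw1 ?mcomp1m.
by crw (esym (etaN X r)); crw (zig1 X (Y \ox ((X \ox Y)^d \ox W))).
Qed.

(** Here the coevaluation of [X \ox Y] inside [mate_tens] cancels against the outer evaluation. *)
Lemma eps_tens X Y W :
  eps (X \ox Y) W \oc (X \ox Y)^d \lw assocV X Y W \oc v X Y (X \ox (Y \ox W)) =
  eps Y W \oc Y^d \lw eps X (Y \ox W).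
Proof.
rewrite mate_tensE.
set g := eps _ W \oc _.
have gE : g = eps (X \ox Y) W \oc (X \ox Y)^d \lw assocV X Y W by [].
clearbody g.
crw (esym (epsN Y g)). crw (lw2 (Y^d) (esym (epsN X (Y \lw g)))).
rewrite -?lwC.
crw (lw2 Y^d (lw2 X^d (esym (assoc_lw X Y g)))); rewrite -?lwC.
rewrite gE -?lwC.
crw (lw2 Y^d (lw2 X^d (esym (etaN (X \ox Y) (assocV X Y W))))); rewrite -?lwC.
crw (lw2 Y^d (lw2 X^d (zig1 (X \ox Y) W))); rewrite -?lwC !lw1 mcompm1.
by crw (lw2 Y^d (lw2 X^d (assocVK X Y W))); rewrite !lw1 mcompm1.
Qed.

Lemma slide_mate_tens Z X Y W :
  b Z (X \ox Y)^d W \oc Z \lw v X Y W =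
  v X Y (Z \ox W) \oc Y^d \lw b Z X^d W \oc b Z Y^d (X^d \ox W).
Proof.
rewrite !mate_tensE -?lwC.
crw (esym (slide_eps Z Y ((X \ox Y)^d \ox W))).
crw (esym (epsN Y (b Z (X \ox Y)^d W))).
crw (bN Z Y^d (eps X (Y \ox ((X \ox Y)^d \ox W)))).
crw (congr1 (fun u => Y^d \lw u)
  (esym (slide_eps Z X (Y \ox ((X \ox Y)^d \ox W))))); rewrite -?lwC.
crw (lw2 Y^d (esym (epsN X (b Z Y ((X \ox Y)^d \ox W))))); rewrite -?lwC.
crw (lw2 Y^d (esym (epsN X (Y \lw b Z (X \ox Y)^d W)))); rewrite -?lwC.
crw (bN Z Y^d (X^d \lw assoc X Y ((X \ox Y)^d \ox W))).
crw (bN Z Y^d (X^d \lw eta (X \ox Y) W)).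
crw (lw2 Y^d (bN Z X^d (assoc X Y ((X \ox Y)^d \ox W)))); rewrite -?lwC.
crw (lw2 Y^d (bN Z X^d (eta (X \ox Y) W))); rewrite -?lwC.
crw (lw3 Y^d (lw3 X^d (esym (hexR Z X Y ((X \ox Y)^d \ox W))))); rewrite -?lwC.
crw (lw2 Y^d (lw2 X^d (esym (assoc_lw X Y (b Z (X \ox Y)^d W))))); rewrite -?lwC.
by crw (lw3 Y^d (lw3 X^d (slide_eta Z (X \ox Y) W))).
Qed.

Lemma rw_assocV A B X Y (g : mor (A \ox B) (X \ox Y)) W :
  g \rw W \oc assocV A B W = assocV X Y W \oc w22 g W.
Proof. by rewrite w22E !mcompA assocK mcomp1m. Qed.

Lemma w22_twist X Y W :
  w22 (twist (X \ox Y)) W =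
  b Y X W \oc b X Y W \oc X \lw (twist Y \rw W) \oc twist X \rw (Y \ox W).
Proof.
have E : twist X \oh twist Y = twist X \rw Y \oc X \lw twist Y.
  by rewrite /rwhisk /lwhisk -tensh_comp mcompm1 mcomp1m.
rewrite twist_tens E -!w22C w22_rw w22_lw -!/(b _ _ _).
crw (b_lw X W (twist Y)); crw (b_rw X W (twist Y)).
crw (b_rw Y W (twist X)); crw (b_lw Y W (twist X)).
by crw (lw_rw (twist X) (twist Y \rw W)).
Qed.

(** The twist of [X \ox Y] is the product of both twists with the double braiding, and this double
    braiding is the one that [sigma_tens] absorbs. *)
Lemma tau_tens X Y W :
  tau (X \ox Y) W \oc assocV X Y _ \oc X \lw (Y \lw v X Y W) =
  tau X W \oc X \lw tau Y (X^d \ox W).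
Proof.
rewrite !tauE; crw (rw_assocV (twist (X \ox Y)) ((X \ox Y)^d \ox W)).
rewrite w22_twist sigmaE.
crw (hexLV X Y (X \ox Y)^d W).
crw (esym (lw_rw (twist X) (Y \lw v X Y W))).
crw (lw2 X (esym (lw_rw (twist Y) (v X Y W)))).
rewrite -?lwC.
crw (bN X Y (v X Y W)); crw (bN Y X (v X Y W)).
crw (lw2 X (slide_mate_tens Y X Y W)); rewrite -?lwC.
rewrite ?mcompA; crw (slide_mate_tens X X Y (Y \ox W)).
crw (eps_tens X Y W).
crw (sigma_tens X Y W).
crw (lw_rw (twist X) (twist Y \rw (Y^d \ox (X^d \ox W)))).
by crw (lw_rw (twist X) (sigma Y (X^d \ox W))).
Qed.

End TensorDual.

(** * Compatibility of word morphisms with tensoring on the right *)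

Section Module.
Variables (k : fieldType) (C : monoidal_category k).
Implicit Types X Y Z W A B : C.

Lemma w22_assoc A B X Y (g : mor (A \ox B) (X \ox Y)) W W' :
  w22 g (W \ox W') \oc A \lw assoc B W W' \oc assoc A (B \ox W) W' =
  X \lw assoc Y W W' \oc assoc X (Y \ox W) W' \oc w22 g W \rw W'.
Proof.
rewrite !w22E -!rwC; crw (esym (pentagon_w X Y W W')).
by crw (assoc_rw W W' g); crw (pentagonV_mid A B W W').
Qed.

Lemma w02_assoc X Y (g : mor tunit (X \ox Y)) W W' :
  w02 g (W \ox W') =
  X \lw assoc Y W W' \oc assoc X (Y \ox W) W' \oc w02 g W \rw W'.
Proof.
rewrite !w02E -!rwC; crw (esym (pentagon_w X Y W W')).
by crw (assoc_rw W W' g); crw (lunitV_tens W W').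
Qed.

Lemma w20_assoc A B (g : mor (A \ox B) tunit) W W' :
  w20 g (W \ox W') \oc A \lw assoc B W W' \oc assoc A (B \ox W) W' =
  w20 g W \rw W'.
Proof.
rewrite !w20E -!rwC -lunit_tens; crw (assoc_rw W W' g).
by crw (pentagonV_mid A B W W').
Qed.

End Module.

(** * Transposes and the partial trace of the double braiding *)

Section PartialTrace.
Variables (k : fieldType) (C : ribbon_category k).
Implicit Types X Y Z W A B : C.
Local Notation b := (@braid_tail k C).
Local Notation "X ^d" := (ldual (X : C) : C).

(** The transpose $f^* : Y^* \to X^*$, acting at the head of a word. *)
Definition mate X Y (f : mor X Y) W : mor (Y^d \ox W) (X^d \ox W) :=
  locked (eps Y (X^d \ox W) \oc Y^d \lw (f \rw (X^d \ox W)) \oc Y^d \lw eta X W).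

Lemma mateE X Y (f : mor X Y) W : mate f W =
  eps Y (X^d \ox W) \oc Y^d \lw (f \rw (X^d \ox W)) \oc Y^d \lw eta X W.
Proof. by rewrite /mate -lock. Qed.

Lemma eta_mate X Y (f : mor X Y) W :
  f \rw (X^d \ox W) \oc eta X W = Y \lw mate f W \oc eta Y W.
Proof.
rewrite mateE -?lwC; crw (esym (etaN Y (eta X W))).
by crw (esym (etaN Y (f \rw (X^d \ox W)))); crw (zig1 Y (X^d \ox W)).
Qed.

Lemma eps_mate X Y (f : mor X Y) W :
  eps X W \oc mate f (X \ox W) = eps Y W \oc Y^d \lw (f \rw W).
Proof.
rewrite mateE; crw (esym (epsN Y (eps X W))).
mrw (lw2 Y^d (lw_rw f (eps X W))).
by mrw (lw2 Y^d (zig1 X W)).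
Qed.

Lemma slide_mate Z X Y (f : mor X Y) W :
  b Z X^d W \oc Z \lw mate f W = mate f (Z \ox W) \oc b Z Y^d W.
Proof.
rewrite !mateE -?lwC; crw (esym (slide_eps Z Y (X^d \ox W))).
crw (esym (epsN Y (b Z X^d W))); crw (bN Z Y^d (f \rw (X^d \ox W))).
crw (bN Z Y^d (eta X W)); mrw (lw2 Y^d (b_lw Z (X^d \ox W) f)).
mrw (lw2 Y^d (lw_rw f (b Z X^d W))).
by mrw (lw3 Y^d (slide_eta Z X W)).
Qed.

Lemma tau_mate X Y (f : mor X Y) W :
  tau X W \oc X \lw mate f W = tau Y W \oc f \rw (Y^d \ox W).
Proof.
rewrite !tauE; crw (esym (lw_rw (twist X) (mate f W))).
rewrite !sigmaE; crw (slide_mate X f W); crw (eps_mate f W).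
crw (esym (b_rw Y^d W f)).
crw (rwC f (twist X) (Y^d \ox W)); crw (rwC (twist Y) f (Y^d \ox W)).
by rewrite twist_nat.
Qed.

(* The partial trace over Y of the double braiding of X with Y, twisted by h. *)
Definition encircle X Y (h : mor Y Y) W : mor (X \ox W) (X \ox W) :=
  locked (X \lw tau Y W \oc b Y X _ \oc b X Y _ \oc X \lw (h \rw (Y^d \ox W)) \oc
          X \lw eta Y W).

Lemma encircleE X Y (h : mor Y Y) W : encircle X h W =
  X \lw tau Y W \oc b Y X _ \oc b X Y _ \oc X \lw (h \rw (Y^d \ox W)) \oc
  X \lw eta Y W.
Proof. by rewrite /encircle -lock. Qed.

(** The morphism [f] travels around the loop: [eta_mate] moves it to the dual strand as its
    transpose, and [tau_mate] brings it back on the other side of [g]. *)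
Lemma encircle_cyclic X Y Y' (f : mor Y Y') (g : mor Y' Y) W :
  encircle X (g \oc f) W = encircle X (f \oc g) W.
Proof.
rewrite !encircleE -!rwC -?lwC ?mcompA; mrw (lw2 X (eta_mate f W)).
mrw (lw2 X (esym (lw_rw g (mate f W)))).
crw (bN X Y (mate f W)); crw (bN Y X (mate f W)).
mrw (lw2 X (tau_mate f W)).
by crw (esym (b_rw X (Y'^d \ox W) f)); crw (esym (b_lw X (Y'^d \ox W) f)).
Qed.

Lemma encircleN X Y (h : mor Y Y) W W' (f : mor W W') :
  encircle X h W' \oc X \lw f = X \lw f \oc encircle X h W.
Proof.
rewrite !encircleE; mrw (lw2 X (etaN Y f)).
mrw (lw2 X (esym (lw_rw h (Y^d \lw f)))).
crw (bN X Y (Y^d \lw f)); crw (bN Y X (Y^d \lw f)).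
by mrw (lw2 X (tauN Y f)).
Qed.

Lemma tau_assoc Y W W' :
  tau Y (W \ox W') \oc Y \lw assoc Y^d W W' \oc assoc Y (Y^d \ox W) W' =
  tau Y W \rw W'.
Proof.
rewrite !tauE -rwC; crw (esym (lw_rw (twist Y) (assoc Y^d W W'))).
crw (esym (assoc_rw (Y^d \ox W) W' (twist Y))).
rewrite !sigmaE -rwC; crw (w22_assoc (braid Y Y^d) W W').
by crw (w20_assoc (ev Y) W W').
Qed.

Lemma encircle_assoc X Y (h : mor Y Y) W W' :
  encircle X h (W \ox W') \oc assoc X W W' =
  assoc X W W' \oc encircle X h W \rw W'.
Proof.
have etaA := w02_assoc (coev Y) W W'; rewrite -!/(eta _ _) in etaA.
have bXYA := w22_assoc (braid X Y) (Y^d \ox W) W'; rewrite -!/(b _ _ _) in bXYA.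
have bYXA := w22_assoc (braid Y X) (Y^d \ox W) W'; rewrite -!/(b _ _ _) in bYXA.
rewrite !encircleE -!rwC etaA -?lwC ?mcompA.
crw (esym (assoc_mw X W' (eta Y W))).
mrw (lw2 X (esym (lw_rw h (assoc Y^d W W')))).
mrw (lw2 X (esym (assoc_rw (Y^d \ox W) W' h))).
crw (esym (assoc_mw X W' (h \rw (Y^d \ox W)))).
crw (bN X Y (assoc Y^d W W')); crw bXYA.
crw (bN Y X (assoc Y^d W W')); crw bYXA.
mrw (lw3 X (tau_assoc Y W W')).
by crw (esym (assoc_mw X W' (tau Y W))).
Qed.

(** Up to [lunit], [W] is [tunit \ox W], where [encircle_assoc] gives the value at [tunit] whiskered
    by [W]. *)
Lemma encircle_scalar X Y (h : mor Y Y) c : encircle X h tunit = c *: mid _ ->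
  forall W, encircle X h W = c *: mid _.
Proof.
move=> e W; apply: (@cancel_epi _ _ _ _ _ (X \lw lunit W) (X \lw lunitV W)).
  by rewrite lwC lunitVK lw1.
rewrite encircleN mcompZl mcomp1m.
suff -> : encircle X h (tunit \ox W) = c *: mid _ by rewrite mcompZr mcompm1.
apply: (@cancel_epi _ _ _ _ _ (assoc X tunit W) (assocV X tunit W)).
  exact: assocVK.
rewrite encircle_assoc e /rwhisk tenshZl tensh1 mcompZl mcompZr.
by rewrite mcomp1m mcompm1.
Qed.

Lemma encircle_simple X Y (h : mor Y Y) :
  (forall f : mor X X, exists c, f = c *: mid X) ->
  exists c, forall W, encircle X h W = c *: mid _.
Proof.
move=> sX; have [c e] := sX (runit X \oc encircle X h tunit \oc runitV X).
exists c; apply: encircle_scalar.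
apply: (@cancel_mono _ _ _ _ _ (runit X) (runitV X)); first exact: runitK.
apply: (@cancel_epi _ _ _ _ _ (runitV X) (runit X)); first exact: runitK.
by rewrite e mcompZr mcompZl mcompm1 runitVK.
Qed.

(** Closing [X \ox Y] amounts to closing [Y] and then [X], by [eta_tens] and [tau_tens]. This
    relates the entries of the S-matrix to [encircle]. *)
Lemma tau_double_braid X Y W :
  tau (X \ox Y) W \oc (braid Y X \oc braid X Y) \rw _ \oc eta (X \ox Y) W =
  tau X W \oc encircle X (mid Y) (X^d \ox W) \oc eta X W.
Proof.
rewrite encircleE rw1 lw1 mcompm1.
have -> : eta (X \ox Y) W = assocV X Y _ \oc
    (X \lw (Y \lw mate_tens X Y W) \oc X \lw eta Y (X^d \ox W) \oc eta X W).
  by rewrite eta_tens mcompA assocK mcomp1m.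
crw (rw_assocV (braid Y X \oc braid X Y) ((X \ox Y)^d \ox W)).
rewrite -w22C -!/(b _ _ _); crw (bN X Y (mate_tens X Y W)).
crw (bN Y X (mate_tens X Y W)); by mrw (tau_tens X Y W).
Qed.

(** The hexagons turn a loop [Y \ox Z] around [X] into two nested loops; the inner one, [Z], acts by
    [c], which factors out. *)
Lemma encircle_tens X Y Z c W :
  (forall W', encircle X (mid Z) W' = c *: mid _) ->
  encircle X (mid (Y \ox Z)) W = c *: encircle X (mid Y) W.
Proof.
move=> phiZ; rewrite !encircleE !rw1 !lw1 !mcompm1.
have -> : eta (Y \ox Z) W = assocV Y Z _ \oc
    (Y \lw (Z \lw mate_tens Y Z W) \oc Y \lw eta Z (Y^d \ox W) \oc eta Y W).
  by rewrite eta_tens mcompA assocK mcomp1m.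
rewrite -?lwC; crw (hexRV X Y Z ((Y \ox Z)^d \ox W)).
crw (hexLV Y Z X ((Y \ox Z)^d \ox W)).
crw (bN X Y (Z \lw mate_tens Y Z W)).
mrw (lw2 Y (bN X Z (mate_tens Y Z W))).
mrw (lw2 Y (bN Z X (mate_tens Y Z W))).
crw (bN Y X (Z \lw mate_tens Y Z W)).
mrw (lw3 X (tau_tens Y Z W)).
crw (esym (bN Y X (tau Z (Y^d \ox W)))); crw (bN X Y (eta Z (Y^d \ox W))).
have := phiZ (Y^d \ox W); rewrite encircleE rw1 lw1 mcompm1 => e.
have E := congr1 (fun u => Y \lw u) e; rewrite /= -?lwC ?lwZ ?lw1 in E.
by crw E; rewrite mcompZr mcompm1 !mcompZl.
Qed.

End PartialTrace.

(** * Dimensions of morphism spaces *)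

Section LinfunE.
Variables (k : fieldType) (U V : vectType k) (f : U -> V) (lf : linear f).
Let f_ := f.
HB.instance Definition _ := GRing.isLinear.Build k U V _ f_ lf.

Lemma linear_linfunE x : linfun f x = f x.
Proof. exact: (lfunE f_). Qed.

End LinfunE.

Section Dimensions.
Variable k : fieldType.

Lemma dim_bij (U V : vectType k) (f : 'Hom(U, V)) (g : V -> U) :
  cancel f g -> cancel g f -> \dim {:U} = \dim {:V}.
Proof.
move=> fK gK; rewrite -(@limg_dim_eq _ _ _ f fullv).
  congr (\dim _); apply/vspaceP => v; rewrite memvf -[v]gK memv_img ?memvf //.
by apply/eqP; rewrite capfv; apply/lker0P/(can_inj fK).
Qed.

Lemma dim_biproduct (V : vectType k) n (U : 'I_n -> vectType k)
    (i : forall a, 'Hom(U a, V)) (p : forall a, 'Hom(V, U a)) :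
  (forall a u, p a (i a u) = u) ->
  (forall a b, a != b -> forall u, p a (i b u) = 0) ->
  (forall v, \sum_a i a (p a v) = v) ->
  \dim {:V} = \sum_a \dim {:U a}.
Proof.
move=> pi pi0 ip.
have full : {:V}%VS = (\sum_a limg (i a))%VS.
  apply/vspaceP => v; rewrite memvf; apply/esym; rewrite -[v]ip.
  by apply: memv_sumr => a _; rewrite memv_img ?memvf.
have dsum : directv (\sum_a limg (i a)).
  apply/directv_sum_independent => us usP us0 a _.
  have : p a (\sum_b us b) = 0 by rewrite us0 linear0.
  rewrite linear_sum (bigD1 a) //= big1 => [|b ba]; last first.
    by have /memv_imgP[u _ ->] := usP b isT; rewrite pi0 // eq_sym.
  by have /memv_imgP[u _ ->] := usP a isT; rewrite pi addr0 => ->;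
    rewrite linear0.
rewrite full (directvP dsum) /=; apply: eq_bigr => a _.
apply: limg_dim_eq; apply/eqP; rewrite capfv; apply/lker0P.
exact: can_inj (pi a).
Qed.

Lemma eigenvector_exists (K : closedFieldType) (V : vectType K) (f : 'End(V)) :
  (0 < \dim {:V})%N -> exists a, exists2 v : V, v != 0 & f v = a *: v.
Proof.
move=> V0; have e_basis := vbasisP {:V}.
set A := passmx.mxof (vbasis {:V}) (vbasis {:V}) f.
have /closed_rootP[a] : size (char_poly A) != 1%N.
  by rewrite size_char_poly; case: (\dim _) V0.
rewrite -eigenvalue_root_char => ev; exists a.
have : passmx.leigenspace f a != 0%VS.
  by rewrite (passmx.leigenspaceE e_basis) passmx.vsof_eq0.
rewrite -vpick0 => v0; exists (vpick (passmx.leigenspace f a)) => //.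
have := memv_pick (passmx.leigenspace f a).
by rewrite memv_ker !lfun_simp subr_eq0 => /eqP.
Qed.

End Dimensions.

(** * Schur's lemma *)

Section Schur.
Variables (k : fieldType) (C : linear_category k).
Implicit Types X Y Z : C.

Definition hom_dim X Y : nat := \dim {:mor X Y}.

Lemma is_zero_mid X : mid X = 0 -> is_zero X.
Proof.
move=> X0 Y; split=> f; first by rewrite -[f]mcompm1 X0 mcomp0r.
by rewrite -[f]mcomp1m X0 mcomp0l.
Qed.

Lemma simple_mid X : simple_object X -> mid X != 0.
Proof. by case=> X0 _; apply/eqP => /is_zero_mid. Qed.

Lemma isomorphic_sym X Y : isomorphic X Y -> isomorphic Y X.
Proof. by case=> f [g [gf fg]]; exists g, f; split. Qed.

Lemma isomorphic_trans X Y Z : isomorphic X Y -> isomorphic Y Z -> isomorphic X Z.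
Proof.
case=> f [f' [f'f ff']] [g [g' [g'g gg']]]; exists (g \oc f), (f' \oc g').
by split; [crw g'g | crw ff'].
Qed.

Lemma postcomp_linear X Y Z (f : mor Y Z) : linear (fun g : mor X Y => f \oc g).
Proof. by move=> a g g'; exact: mcomp_linr. Qed.

Lemma precomp_linear X Y Z (f : mor X Y) : linear (fun g : mor Y Z => g \oc f).
Proof. by move=> a g g'; exact: mcomp_linl. Qed.

Lemma hom_dim_isor X Y Z : isomorphic Y Z -> hom_dim X Y = hom_dim X Z.
Proof.
have homE := fun A B D g => linear_linfunE (@postcomp_linear A B D g).
case=> f [g [gf fg]]; rewrite /hom_dim; apply: (@dim_bij _ _ _
  (linfun (fun h : mor X Y => f \oc h)) (fun h => g \oc h)) => h.
  by rewrite homE mcompA gf mcomp1m.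
by rewrite homE mcompA fg mcomp1m.
Qed.

Lemma hom_dim_isol X Y Z : isomorphic X Y -> hom_dim X Z = hom_dim Y Z.
Proof.
have homE := fun A B D g => linear_linfunE (@precomp_linear A B D g).
case=> f [g [gf fg]]; rewrite /hom_dim; apply: (@dim_bij _ _ _
  (linfun (fun h : mor X Z => h \oc g)) (fun h => h \oc f)) => h.
  by rewrite homE -mcompA gf mcompm1.
by rewrite homE -mcompA fg mcompm1.
Qed.

Lemma hom_dim_sumr X Y n (S : 'I_n -> C) :
  is_direct_sum S Y -> hom_dim X Y = \sum_a hom_dim X (S a).
Proof.
have homE := fun A B D g => linear_linfunE (@postcomp_linear A B D g).
case=> i [p [pi pi0 ip]]; rewrite /hom_dim; apply: (@dim_biproduct _ _ _ _
  (fun a => linfun (fun h : mor X (S a) => i a \oc h))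
  (fun a => linfun (fun h : mor X Y => p a \oc h))).
- by move=> a u; rewrite !homE mcompA pi mcomp1m.
- by move=> a b ab u; rewrite !homE mcompA pi0 // mcomp0l.
move=> v; under eq_bigr => a _ do rewrite !homE mcompA.
by rewrite -mcomp_suml ip mcomp1m.
Qed.

Lemma hom_dim_suml X Y n (S : 'I_n -> C) :
  is_direct_sum S X -> hom_dim X Y = \sum_a hom_dim (S a) Y.
Proof.
have homE := fun A B D g => linear_linfunE (@precomp_linear A B D g).
case=> i [p [pi pi0 ip]]; rewrite /hom_dim; apply: (@dim_biproduct _ _ _ _
  (fun a => linfun (fun h : mor (S a) Y => h \oc p a))
  (fun a => linfun (fun h : mor X Y => h \oc i a))).
- by move=> a u; rewrite !homE -mcompA pi mcompm1.
- by move=> a b ab u; rewrite !homE -mcompA pi0 ?mcomp0r // eq_sym.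
move=> v; under eq_bigr => a _ do rewrite !homE -mcompA.
by rewrite -mcomp_sumr ip mcompm1.
Qed.

Hypothesis abC : abelian_category C.

(** The kernel of [f] is a subobject of the simple [X], and not all of it as [f] is nonzero; so [f]
    is mono and exhibits the nonzero [X] as a subobject of the simple [Y]. *)
Lemma simple_iso X Y (f : mor X Y) :
  simple_object X -> simple_object Y -> f != 0 -> is_iso f.
Proof.
move=> [X0 Xs] [Y0 Ys] f0.
have [_ [/(_ X Y f)[K [i [fi0 iP]]] _]] := abC.
have i_mono : is_mono i.
  move=> W u v iuv.
  have [w [_ wP]] : exists! w, i \oc w = i \oc u.
    by apply: iP; rewrite mcompA fi0 mcomp0l.
  by rewrite -(wP u erefl) -(wP v).
have {Xs}[K0|[j [ji ij]]] := Xs _ _ i_mono; last first.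
  by case/eqP: f0; rewrite -[f]mcompm1 -ij mcompA fi0 mcomp0l.
have f_mono : is_mono f.
  move=> W u v fuv; apply/eqP; rewrite -subr_eq0; apply/eqP.
  have [w [<- _]] : exists! w, i \oc w = u - v.
    by apply: iP; rewrite mcompDr -[- v]scaleN1r mcompZr fuv scaleN1r subrr.
  by have [_ /(_ w)->] := K0 W; rewrite mcomp0r.
by have [] := Ys _ _ f_mono.
Qed.

Lemma hom_dim_nonisomorphic X Y : simple_object X -> simple_object Y ->
  ~ isomorphic X Y -> hom_dim X Y = 0%N.
Proof.
move=> sX sY nXY; apply/eqP; rewrite dimv_eq0 -subv0; apply/subvP => f _.
rewrite memv0; apply/negP => /negP f0.
by apply: nXY; exists f; apply: simple_iso.
Qed.

End Schur.

Section ClosedField.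
Variables (k : closedFieldType) (C : linear_category k).
Hypothesis abC : abelian_category C.
Implicit Types X Y Z : C.

(** Composition with [f] has an eigenvector [g] over a closed field; [g] is invertible by Schur's
    lemma and cancels from the eigenvalue equation. *)
Lemma simple_endomorphism X (f : mor X X) :
  simple_object X -> exists c, f = c *: mid X.
Proof.
move=> sX; pose F := linfun (fun g : mor X X => f \oc g).
have FE g : F g = f \oc g := linear_linfunE (@postcomp_linear _ _ X X X f) g.
have dimX : (0 < \dim {:mor X X})%N.
  by rewrite lt0n dimv_eq0 -subv0; apply/subvP => /(_ (mid X) (memvf _));
    rewrite memv0 (negPf (simple_mid sX)).
have [c [g g0]] := @eigenvector_exists _ _ F dimX.
rewrite FE => fg; have [h [_ gh]] := simple_iso abC sX sX g0.
by exists c; rewrite -[f]mcompm1 -gh mcompA fg mcompZl.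
Qed.

Lemma hom_dim_simple_self X : simple_object X -> hom_dim X X = 1%N.
Proof.
move=> sX; rewrite /hom_dim; have -> : {:mor X X}%VS = <[mid X]>%VS.
  apply/eqP; rewrite eqEsubv subvf andbT; apply/subvP => f _.
  by have [c ->] := simple_endomorphism f sX; rewrite rpredZ ?memv_line.
by rewrite dim_vline simple_mid.
Qed.

Lemma hom_dim_simple X Y : simple_object X -> simple_object Y ->
  hom_dim X Y = `[< isomorphic X Y >].
Proof.
move=> sX sY; case: asboolP => [XY|nXY]; last exact: hom_dim_nonisomorphic.
by rewrite -(hom_dim_isor X XY) hom_dim_simple_self.
Qed.

End ClosedField.

(** * Multiplicities of simple objects *)

Section Multiplicity.
Variables (k : closedFieldType) (C : fusion_category k).
Implicit Types X Y Z S : C.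
Let abC := fusion_abelian C.

Lemma asbool_isomorphic_sym (X Y : C) :
  `[< isomorphic X Y >] = `[< isomorphic Y X >].
Proof. by apply: asbool_equiv_eq; split; apply: isomorphic_sym. Qed.

Lemma hom_dim_count S Y n (T : 'I_n -> C) : simple_object S ->
  (forall a, simple_object (T a)) -> is_direct_sum T Y ->
  hom_dim S Y = #|[pred a | `[< isomorphic (T a) S >]]|.
Proof.
move=> sS sT TY; rewrite (hom_dim_sumr S TY) -sum1_card [RHS]big_mkcond /=.
apply: eq_bigr => a _; rewrite (hom_dim_simple abC) // asbool_isomorphic_sym.
by rewrite inE; case: asboolP.
Qed.

(** The value chosen by [xget] is the count in some decomposition, and every such count is this
    dimension. *)
Lemma multiplicityE S Y : simple_object S -> multiplicity S Y = hom_dim S Y.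
Proof.
move=> sS; rewrite /multiplicity; set P := (X in xget _ X).
have [n [T [sT TY]]] := fusion_semisimple Y.
have : P (xget 0%N P).
  by apply: xgetPex; exists #|[pred a | `[< isomorphic (T a) S >]]|, n, T.
case=> n' [T' [sT' TY' ->]]; by rewrite (hom_dim_count sS sT' TY').
Qed.

Lemma hom_dimC S Y : simple_object S -> hom_dim Y S = hom_dim S Y.
Proof.
move=> sS; have [n [T [sT TY]]] := fusion_semisimple Y.
rewrite (hom_dim_sumr S TY) (hom_dim_suml S TY); apply: eq_bigr => a _.
by rewrite !(hom_dim_simple abC) // asbool_isomorphic_sym.
Qed.

Variables (m : nat) (X : 'I_m -> C) (hX : simple_representatives X).

(** Serves twice: for dimensions of morphism spaces and for the scalars by which loops act. *)
Lemma additive_decomposition (V : nmodType) (F : C -> V) :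
  (forall Y Z, isomorphic Y Z -> F Y = F Z) ->
  (forall n (T : 'I_n -> C) Y, is_direct_sum T Y -> F Y = \sum_a F (T a)) ->
  forall Y, F Y = \sum_l F (X l) *+ multiplicity (X l) Y.
Proof.
move=> Fiso Fsum Y; have [sX Xinj Xrep] := hX.
have [n [T [sT TY]]] := fusion_semisimple Y.
rewrite (Fsum _ _ _ TY).
under [RHS]eq_bigr => l _ do
  rewrite multiplicityE // (hom_dim_sumr _ TY) -sumrMnr.
rewrite exchange_big /=; apply: eq_bigr => a _.
have [l Tl] := Xrep _ (sT a).
rewrite (bigD1 l) //= big1 ?addr0.
  rewrite (hom_dim_simple abC) //; case: asboolP => [_|]; last first.
    by case; apply: isomorphic_sym.
  by rewrite mulr1n; apply: Fiso.
move=> l' l'l; rewrite (hom_dim_simple abC) //; case: asboolP => [Xl'|_] //.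
case/eqP: l'l; apply: Xinj; exact: isomorphic_trans Xl' Tl.
Qed.

(** Endomorphisms of a sum of [n] simple objects have dimension at least [n], and 0 if [n] is 0;
    [fusion_unit] thus leaves only one summand. *)
Lemma unit_representative : exists o, isomorphic (tunit : C) (X o).
Proof.
have [sX _ Xrep] := hX.
have [n [T [sT TY]]] := fusion_semisimple (tunit : C).
have d1 : hom_dim (tunit : C) tunit = 1%N := fusion_unit C.
have n1 : n = 1%N.
  move: (d1); rewrite (hom_dim_suml _ TY).
  under eq_bigr => a _ do rewrite (hom_dim_sumr _ TY).
  have [n0|n0] := posnP n; first by subst n; rewrite big_ord0.
  move=> e; apply/eqP; rewrite eqn_leq n0 andbT -e -{1}(card_ord n) -sum1_card.
  apply: leq_sum => a _; rewrite (bigD1 a) //= hom_dim_simple_self //.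
subst n; have [i [p [pi _ ip]]] := TY.
have [o To] := Xrep _ (sT ord0); exists o; apply: isomorphic_trans To.
by exists (p ord0), (i ord0); split; rewrite ?pi // -ip big_ord1.
Qed.

End Multiplicity.

Section TensorSums.
Variables (k : fieldType) (C : monoidal_category k).
Implicit Types X Y Z W : C.

Lemma direct_sum_tensl n (T : 'I_n -> C) Y W :
  is_direct_sum T Y -> is_direct_sum (fun a => T a \ox W) (Y \ox W).
Proof.
case=> i [p [pi pi0 ip]]; exists (fun a => i a \rw W), (fun a => p a \rw W).
split=> [a|a b ab|].
- by rewrite rwC pi rw1.
- by rewrite rwC pi0 // /rwhisk tensh0l.
by under eq_bigr => a _ do rewrite rwC /rwhisk; rewrite -tensh_suml ip tensh1.
Qed.

Lemma isomorphic_tensl Y Z W : isomorphic Y Z -> isomorphic (Y \ox W) (Z \ox W).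
Proof.
by case=> f [g [gf fg]]; exists (f \rw W), (g \rw W); split;
  rewrite rwC ?gf ?fg rw1.
Qed.

End TensorSums.

(** * The S-matrix *)

Section Trace.
Variables (k : fieldType) (C : ribbon_category k).
Implicit Types X Y Z W : C.
Local Notation b := (@braid_tail k C).
Local Notation "X ^d" := (ldual (X : C) : C).

Lemma mid_tunit : mid (tunit : C) != 0.
Proof.
apply/eqP => /is_zero_mid/(_ tunit)[C0 _].
have := fusion_unit C; have -> : {:mor (tunit : C) tunit}%VS = 0%VS.
  by apply/eqP; rewrite -subv0; apply/subvP => f _; rewrite memv0 [f]C0.
by rewrite dimv0.
Qed.

Lemma scale_mid_inj (a c : k) (X : C) : mid X != 0 ->
  a *: mid X = c *: mid X -> a = c.
Proof.
move=> X0 /eqP; rewrite -subr_eq0 -scalerBl scaler_eq0 (negPf X0) orbF.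
by rewrite subr_eq0 => /eqP.
Qed.

Lemma unit_scalarE (t : mor (tunit : C) tunit) :
  t = unit_scalar t *: mid tunit.
Proof.
have bas : basis_of {:mor (tunit : C) tunit} [tuple mid (tunit : C)].
  rewrite basisEfree subvf fusion_unit /= andbT.
  by rewrite seq1_free mid_tunit.
by rewrite {1}(coord_basis bas (memvf t)) big_ord1.
Qed.

(** The word maps merge into a single endomorphism of [tunit], the one whose scalar defines
    [qtrace f]. *)
Lemma qtraceE X (f : mor X X) W :
  tau X W \oc f \rw (X^d \ox W) \oc eta X W = qtrace f *: mid W.
Proof.
rewrite tauE; crw (rwC (twist X) f (X^d \ox W)).
rewrite sigmaE -w22_rw /eps /b /eta; crw (w20_22 (ev X) (braid X X^d) W).
crw (w20_22 (ev X \oc braid X X^d) ((twist X \oc f) \rw X^d) W).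
rewrite w20_02 [X in lunit W \oc X \rw W]unit_scalarE -/(qtrace f).
by rewrite /rwhisk tenshZl tensh1 mcompZr mcompZl mcompm1 lunitVK.
Qed.

Lemma qtrace_cyclic X Y (f : mor X Y) (g : mor Y X) :
  qtrace (g \oc f) = qtrace (f \oc g).
Proof.
apply: (scale_mid_inj mid_tunit); rewrite -!qtraceE -!rwC.
crw (eta_mate f tunit); crw (esym (lw_rw g (mate f tunit))).
by crw (tau_mate f tunit).
Qed.

Lemma Smatrix_sym m (X : 'I_m -> C) i j : Smatrix X i j = Smatrix X j i.
Proof. by rewrite !mxE qtrace_cyclic. Qed.

Lemma hom_dim_adjoint X Y Z : hom_dim (X^d \ox Y) Z = hom_dim Y (X \ox Z).
Proof.
pose F (f : mor (X^d \ox Y) Z) := X \lw f \oc eta X Y.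
have linF : linear F.
  by move=> a f g; rewrite /F /lwhisk tensh_linr mcomp_linl.
have FE := linear_linfunE linF.
apply: (@dim_bij _ _ _ (linfun F) (fun g => eps X Z \oc X^d \lw g)) => f.
  rewrite FE /F -lwC; crw (epsN X f).
  by crw (zig2 X Y).
rewrite FE /F -lwC; crw (esym (etaN X f)).
by crw (zig1 X Z).
Qed.

Lemma encircle_sum X Y n (h : 'I_n -> mor Y Y) W :
  encircle X (\sum_a h a) W = \sum_a encircle X (h a) W.
Proof.
rewrite encircleE /rwhisk tensh_suml /lwhisk tensh_sumr mcomp_sumr mcomp_suml.
by apply: eq_bigr => a _; rewrite encircleE.
Qed.

Lemma encircle_direct_sum X Y n (T : 'I_n -> C) W : is_direct_sum T Y ->
  encircle X (mid Y) W = \sum_a encircle X (mid (T a)) W.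
Proof.
case=> i [p [pi pi0 <-]]; rewrite encircle_sum; apply: eq_bigr => a _.
by rewrite encircle_cyclic pi.
Qed.

Lemma encircle_isomorphic X Y Z W : isomorphic Y Z ->
  encircle X (mid Y) W = encircle X (mid Z) W.
Proof. by case=> f [g [<- <-]]; rewrite encircle_cyclic. Qed.

End Trace.

(** * Fusion coefficients and the scalars of loops *)

Section FusionData.
Variables (k : closedFieldType) (C : ribbon_category k).
Variables (m : nat) (X : 'I_m -> C) (hX : simple_representatives X).
Let sX : forall i, simple_object (X i).
Proof. by case: hX. Qed.
Let abC := fusion_abelian C.

Definition fusion_coef i j l : nat := multiplicity (X l) (X i \ox X j).
(** The class of the dual of [X i], kept as a vector of multiplicities. *)
Definition dual_mult i a : nat := multiplicity (X a) (ldual (X i)).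

Lemma hom_dim_representatives i j : hom_dim (X i) (X j) = (i == j).
Proof.
rewrite (hom_dim_simple abC) //; case: asboolP => [Xij|nXij].
  by case: hX => _ Xinj _; rewrite (Xinj _ _ Xij) eqxx.
case: eqP => // ij; case: nXij; rewrite ij; exists (mid _), (mid _).
by split; rewrite mcomp1m.
Qed.

Lemma fusion_data_unit : exists o,
  (forall l, multiplicity (X l) tunit = (l == o)) /\
  (forall i l, fusion_coef o i l = (i == l)).
Proof.
have [o Xo] := unit_representative hX; exists o; split=> [l|i l].
  by rewrite multiplicityE // (hom_dim_isor _ Xo) hom_dim_representatives.
rewrite /fusion_coef multiplicityE // eq_sym -hom_dim_representatives.
apply/esym/hom_dim_isor.
apply: (isomorphic_trans _ (isomorphic_tensl (X i) Xo)).
by apply: isomorphic_sym; exists (lunit (X i)), (lunitV (X i)); exact: lunitP.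
Qed.

(** The adjunction [hom_dim_adjoint] moves [X i] across as its dual, which is then decomposed into
    simple objects. *)
Lemma fusion_reciprocity i j l :
  \sum_a dual_mult i a * fusion_coef a j l = fusion_coef i l j.
Proof.
rewrite /fusion_coef [RHS]multiplicityE // -hom_dim_adjoint.
pose F (Y : C) := hom_dim (Y \ox X j) (X l).
rewrite -[RHS]/(F (ldual (X i))) (@additive_decomposition _ _ _ _ hX _ F).
- apply: eq_bigr => a _; rewrite multiplicityE // -hom_dimC //.
  by rewrite -/(F (X a)) -[RHS]mulr_natl natn.
- by move=> Y Z YZ; apply/hom_dim_isol/isomorphic_tensl.
- by move=> n T Y TY; apply/hom_dim_suml/direct_sum_tensl.
Qed.

Lemma S_characters : exists (L : 'I_m -> 'I_m -> k) (d : 'I_m -> k),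
  (forall i j l, L i j * L i l = \sum_a (fusion_coef j l a)%:R * L i a) /\
  (forall i j, Smatrix X i j = L i j * d i).
Proof.
have /choice[L LP] (i : 'I_m) : exists L : C -> k,
    forall Y W, encircle (X i) (mid Y) W = L Y *: mid _.
  have /choice[L LP] (Y : C) : exists c : k,
      forall W, encircle (X i) (mid Y) W = c *: mid _.
    by apply: encircle_simple => f; apply: simple_endomorphism.
  by exists L.
have Xi0 i : mid (X i \ox tunit) != 0.
  apply/eqP => Xi0; have /eqP := simple_mid (sX i); apply.
  by rewrite -(runitVK (X i)) -[runit _]mcompm1 Xi0 mcomp0r mcomp0l.
have Liso i Y Z : isomorphic Y Z -> L i Y = L i Z.
  move=> YZ; apply: (scale_mid_inj (Xi0 i)); rewrite -!LP.
  exact: encircle_isomorphic.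
have Lsum i n (T : 'I_n -> C) Y : is_direct_sum T Y -> L i Y = \sum_a L i (T a).
  move=> TY; apply: (scale_mid_inj (Xi0 i)); rewrite -LP scaler_suml.
  by rewrite (encircle_direct_sum _ _ TY); apply: eq_bigr => a _; rewrite LP.
have Ltens i Y Z : L i (Y \ox Z) = L i Z * L i Y.
  apply: (scale_mid_inj (Xi0 i)); rewrite -LP -scalerA -LP.
  by apply: encircle_tens => W; apply: LP.
exists (fun i j => L i (X j)), (fun i => qtrace (mid (X i))); split=> i j.
  move=> l; rewrite mulrC -Ltens.
  rewrite (additive_decomposition hX (Liso i) (Lsum i)); apply: eq_bigr => a _.
  by rewrite mulr_natl.
(* Closing [X j] first gives the scalar [L i (X j)]; closing [X i] afterwards gives its quantum
   dimension. *)
rewrite mxE; apply: (scale_mid_inj (mid_tunit C)).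
rewrite -qtraceE tau_double_braid LP mcompZr mcompm1 mcompZl -scalerA -qtraceE.
by rewrite rw1 mcompm1.
Qed.

End FusionData.

(** * Characters of a fusion ring with an S-matrix *)

Section FusionRing.
Variables (F : numClosedFieldType) (m : nat).
Variables (N : 'I_m -> 'I_m -> 'I_m -> nat) (D : 'I_m -> 'I_m -> nat).
Variables (o : 'I_m) (L : 'I_m -> 'I_m -> F) (d : 'I_m -> F).
Implicit Types i j k l a b p q : 'I_m.

Hypothesis N_unit : forall i l, N o i l = (i == l).
Hypothesis N_dual : forall i j l,
  \sum_a (D i a)%:R * (N a j l)%:R = (N i l j)%:R :> F.
Hypothesis L_mul : forall i j l, L i j * L i l = \sum_a (N j l a)%:R * L i a.
Hypothesis S_unit : \matrix_(i < m, j < m) (L i j * d i) \in unitmx.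
Hypothesis S_sym : forall i j, L i j * d i = L j i * d j.

(** The coordinate of $x_i x_i^*$ at $x_b$. *)
Definition dual_coord i b : F :=
  \sum_a (D i a)%:R * (N i a b)%:R.
Definition ring_grouplike i := forall b, dual_coord i b = (b == o)%:R.

Lemma d_neq0 i : d i != 0.
Proof.
apply/eqP => di0; have := congr1 (fun A : 'M_m => A i i) (mulmxV S_unit).
rewrite !mxE eqxx big1 => [/eqP|j _]; first by rewrite eq_sym oner_eq0.
by rewrite mxE di0 mulr0 mul0r.
Qed.

Lemma L_unit : \matrix_(i < m, j < m) L i j \in unitmx.
Proof.
have SE : \matrix_(i < m, j < m) (L i j * d i) =
    diag_mx (\row_i d i) *m \matrix_(i < m, j < m) L i j.
  by apply/matrixP => i j; rewrite mul_diag_mx !mxE mulrC.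
by move: S_unit; rewrite SE unitmx_mul => /andP[].
Qed.

Lemma L_separates (v : 'I_m -> F) :
  (forall i, \sum_j L i j * v j = 0) -> forall j, v j = 0.
Proof.
move=> Lv0 j; pose V := \col_j v j.
have : (\matrix_(i < m, j < m) L i j) *m V = 0.
  apply/matrixP => i z; rewrite !mxE -[RHS](Lv0 i).
  by apply: eq_bigr => l _; rewrite !mxE.
move/(congr1 (mulmx (invmx (\matrix_(i < m, j < m) L i j)))).
rewrite mulKmx ?L_unit // mulmx0 => /matrixP/(_ j 0).
by rewrite !mxE.
Qed.

Lemma L_spans (u : 'I_m -> F) :
  exists c : 'I_m -> F, forall k, u k = \sum_i c i * L i k.
Proof.
pose c := (\row_k u k) *m invmx (\matrix_(i < m, j < m) L i j).
exists (fun i => c 0 i) => k; have := mulmxKV L_unit (\row_k u k).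
move/matrixP/(_ 0 k); rewrite !mxE => <-.
by apply: eq_bigr => i _; rewrite !mxE.
Qed.

Lemma L_free (c : 'I_m -> F) :
  (forall j, \sum_i c i * L i j = 0) -> forall i, c i = 0.
Proof.
move=> cL0 i; have : (\row_i c i) *m (\matrix_(i < m, j < m) L i j) = 0.
  apply/matrixP => z j; rewrite !mxE -[RHS](cL0 j).
  by apply: eq_bigr => l _; rewrite !mxE.
move/(congr1 (mulmxr (invmx (\matrix_(i < m, j < m) L i j)))).
rewrite /= mulmxK ?L_unit // mul0mx => /matrixP/(_ 0 i).
by rewrite !mxE.
Qed.

Lemma L_inj i j : (forall q, L i q = L j q) -> i = j.
Proof.
move=> Lij; apply/eqP/negPn/negP => nij.
have /L_free/(_ i) : forall q, \sum_l ((l == i)%:R - (l == j)%:R) * L l q = 0.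
  move=> q; under eq_bigr do rewrite mulrBl.
  rewrite sumrB (bigD1 i) //= [X in _ - X](bigD1 j) //= !eqxx !mul1r Lij.
  rewrite !big1 ?addr0 ?subrr // => l /negPf->; exact: mul0r.
by move/eqP; rewrite eqxx (negPf nij) subr0 oner_eq0.
Qed.

(** Multiplying by the unit fixes every value [L i j], and one of these is nonzero by independence
    of the rows. *)
Lemma L_one i : L i o = 1.
Proof.
have [j Lij] : exists j, L i j != 0.
  apply: contrapT => /forallNP Li0.
  have /L_free/(_ i)/eqP : forall j, \sum_l (l == i)%:R * L l j = 0.
    move=> j; rewrite (bigD1 i) //= eqxx mul1r big1 => [|l /negPf->].
      by rewrite addr0; apply/eqP/negPn/negP/Li0.
    exact: mul0r.
  by rewrite eqxx oner_eq0.
apply: (mulIf Lij); rewrite L_mul mul1r (bigD1 j) //= N_unit eqxx mul1r.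
by rewrite big1 ?addr0 // => a aj; rewrite N_unit eq_sym (negPf aj) mul0r.
Qed.

(** All characters agree on both products, and they separate elements. *)
Lemma N_comm i j l : N i j l = N j i l.
Proof.
apply/eqP; rewrite -(eqr_nat F) -subr_eq0; apply/eqP.
apply: (L_separates (v := fun l => (N i j l)%:R - (N j i l)%:R)) => q.
under eq_bigr do rewrite mulrC mulrBl.
by rewrite sumrB -!L_mul mulrC subrr.
Qed.

Definition L_norm i := \sum_k L i k * (L i k)^*.

Lemma L_norm_gt0 i : 0 < L_norm i.
Proof.
rewrite /L_norm (bigD1 o) //= L_one conjC1 mulr1.
apply: (lt_le_trans ltr01); rewrite lerDl sumr_ge0 // => k _.
exact: mul_conjC_ge0.
Qed.

(** By reciprocity, multiplication by $x_j^*$ has the transposed matrix of multiplication by $x_j$;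
    so [L i] is an eigenvector of both. *)
Lemma dual_eigen i j l :
  (\sum_a (D j a)%:R * L i a) * L i l = \sum_b (N j b l)%:R * L i b.
Proof.
rewrite mulr_suml; under eq_bigr => a _ do rewrite -mulrA L_mul mulr_sumr.
rewrite exchange_big /=; apply: eq_bigr => b _.
by under eq_bigr => a _ do rewrite mulrA; rewrite -mulr_suml N_dual.
Qed.

(** A real matrix and its transpose share the eigenvector [L i]. Pairing both images with [L i] in
    the Hermitian form shows that the eigenvalues are conjugate. *)
Lemma L_dual i j : \sum_a (D j a)%:R * L i a = (L i j)^*.
Proof.
have n0 : L_norm i != 0 by rewrite gt_eqF ?L_norm_gt0.
apply: (mulIf n0); rewrite -[in RHS](conjCK (L_norm i)) -rmorphM /=.
have -> : (L_norm i)^* = L_norm i.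
  rewrite rmorph_sum /=; apply: eq_bigr => k _.
  by rewrite rmorphM /= conjCK mulrC.
have -> : (\sum_a (D j a)%:R * L i a) * L_norm i =
    \sum_l \sum_b (N j b l)%:R * (L i b * (L i l)^*).
  rewrite mulr_sumr; apply: eq_bigr => l _; rewrite mulrA dual_eigen mulr_suml.
  by apply: eq_bigr => b _; rewrite mulrA.
have -> : L i j * L_norm i = \sum_b \sum_l (N j b l)%:R * (L i l * (L i b)^*).
  rewrite mulr_sumr; apply: eq_bigr => l _; rewrite mulrA L_mul mulr_suml.
  by apply: eq_bigr => b _; rewrite mulrA.
rewrite rmorph_sum /= exchange_big /=; apply: eq_bigr => b _.
rewrite rmorph_sum /=; apply: eq_bigr => l _.
by rewrite !rmorphM /= conjC_nat conjCK [L i b * _]mulrC.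
Qed.

Lemma L_mul_conj i j : L i j * (L i j)^* = \sum_b dual_coord j b * L i b.
Proof.
rewrite -L_dual mulr_sumr.
under eq_bigr => a _ do rewrite mulrCA L_mul mulr_sumr.
rewrite exchange_big /=; apply: eq_bigr => b _; rewrite mulr_suml.
by apply: eq_bigr => a _; rewrite mulrA.
Qed.

Lemma dual_coord_ge0 i b : 0 <= dual_coord i b.
Proof. by apply: sumr_ge0 => a _; rewrite mulr_ge0 ?ler0n. Qed.

Lemma dual_coord_unit i : dual_coord i o = 1.
Proof.
rewrite /dual_coord; under eq_bigr => a _ do rewrite N_comm.
by rewrite N_dual N_comm N_unit eqxx.
Qed.

(** By [L_mul_conj], the condition says that every character takes on $x_i x_i^*$ its value at the
    unit; characters separate elements. *)
Lemma grouplike_norm i :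
  ring_grouplike i <-> forall j, L j i * (L j i)^* = 1.
Proof.
split=> [gi j|Li b].
  rewrite L_mul_conj (bigD1 o) //= gi eqxx L_one mulr1 big1 ?addr0 // => b bo.
  by rewrite gi (negPf bo) mul0r.
apply/eqP; rewrite -subr_eq0; apply/eqP; move: b.
apply: L_separates => j; under eq_bigr do rewrite mulrC mulrBl.
rewrite sumrB -L_mul_conj Li (bigD1 o) //= eqxx mul1r L_one big1 ?addr0 ?subrr //.
by move=> b /negPf->; rewrite mul0r.
Qed.

(** Take [q] where the characters differ: multiplication by $x_q$ has distinct eigenvalues on them,
    and its adjoint acts on [L j] by the conjugate eigenvalue. *)
Lemma L_orthogonal i j : i != j -> \sum_k L i k * (L j k)^* = 0.
Proof.
move=> ij; have [q Lq] : exists q, L i q != L j q.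
  apply: contrapT => /forallNP Lij; case/eqP: ij; apply: L_inj => q.
  by apply/eqP/negPn/negP/Lij.
apply/eqP; have : (L i q - L j q) * (\sum_k L i k * (L j k)^*) == 0.
  rewrite mulrBl subr_eq0 !mulr_sumr; apply/eqP.
  under eq_bigr => k _ do rewrite mulrA L_mul mulr_suml.
  rewrite exchange_big /=; apply: eq_bigr => b _.
  rewrite mulrCA -[L j q]conjCK -rmorphM /= -L_dual dual_eigen rmorph_sum /=.
  rewrite mulr_sumr; apply: eq_bigr => k _.
  by rewrite rmorphM /= conjC_nat mulrA [L i b * _]mulrC.
by rewrite mulf_eq0 subr_eq0 (negPf Lq).
Qed.

(* A symmetric matrix with nonnegative entries, of which the characters form an
   orthogonal eigenbasis. *)
Let A k l : F := \sum_j ((N j k l)%:R + (N j l k)%:R).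
Let t i : F := \sum_j (L i j + (L i j)^*).

Let A_ge0 k l : 0 <= A k l.
Proof. by apply: sumr_ge0 => j _; rewrite addr_ge0 ?ler0n. Qed.

Let A_sym k l : A k l = A l k.
Proof. by apply: eq_bigr => j _; rewrite addrC. Qed.

(** Every index is linked directly to the unit, which stands in for irreducibility in the
    Perron-Frobenius argument. *)
Let A_unit k : A k o != 0.
Proof.
rewrite gt_eqF // (lt_le_trans (@ltr01 F)) // /A (bigD1 k) //=.
rewrite [N k o k]N_comm N_unit eqxx addrAC lerDr.
rewrite addr_ge0 ?ler0n ?sumr_ge0 // => j _.
by rewrite addr_ge0 ?ler0n.
Qed.

Let A_eigen i k : \sum_l A k l * L i l = t i * L i k.
Proof.
rewrite /A mulr_suml; under eq_bigr do rewrite mulr_suml.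
rewrite exchange_big /=; apply: eq_bigr => j _.
rewrite mulrDl -L_dual dual_eigen L_mul -big_split /=.
by apply: eq_bigr => l _; rewrite mulrDl.
Qed.

Let t_real i : t i \is Num.real.
Proof.
by apply: rpred_sum => j _; rewrite CrealE rmorphD /= conjCK addrC.
Qed.

(** In the orthogonal eigenbasis both sides become sums of $|c_i|^2$ times [L_norm i], weighted by
    [t i] and by [t p]. *)
Let rayleigh p (u : 'I_m -> F) : (forall i, t i <= t p) ->
  \sum_k (\sum_l A k l * u l) * (u k)^* <= t p * \sum_k u k * (u k)^*.
Proof.
move=> tp; have [c uE] := L_spans u.
have gram (s : 'I_m -> F) :
    \sum_k (\sum_i s i * (c i * L i k)) * (u k)^* =
    \sum_i s i * (c i * (c i)^* * L_norm i).
  under eq_bigr => k _ do rewrite mulr_suml.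
  rewrite exchange_big /=; apply: eq_bigr => i _.
  under eq_bigr => k _ do rewrite uE rmorph_sum mulr_sumr /=.
  rewrite exchange_big (bigD1 i) //= [X in _ + X]big1 ?addr0 => [|j ji].
    rewrite !mulr_sumr; apply: eq_bigr => k _; rewrite rmorphM /=.
    by rewrite -!mulrA; congr (_ * (_ * _)); rewrite mulrCA.
  transitivity (s i * c i * (c j)^* * \sum_k L i k * (L j k)^*).
    rewrite mulr_sumr; apply: eq_bigr => k _; rewrite rmorphM /=.
    by rewrite -!mulrA; congr (_ * (_ * _)); rewrite mulrCA.
  by rewrite L_orthogonal ?mulr0 // eq_sym.
have -> : \sum_k (\sum_l A k l * u l) * (u k)^* =
    \sum_k (\sum_i t i * (c i * L i k)) * (u k)^*.
  apply: eq_bigr => k _; congr (_ * _).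
  under eq_bigr => l _ do rewrite uE mulr_sumr.
  rewrite exchange_big /=; apply: eq_bigr => i _.
  rewrite mulrCA -A_eigen mulr_sumr; apply: eq_bigr => l _.
  by rewrite mulrCA.
have -> : t p * \sum_k u k * (u k)^* =
    \sum_k (\sum_i t p * (c i * L i k)) * (u k)^*.
  rewrite mulr_sumr; apply: eq_bigr => k _.
  by rewrite -mulr_sumr -uE mulrA.
rewrite !gram; apply: ler_sum => i _; apply: ler_wpM2r (tp i).
by rewrite mulr_ge0 ?mul_conjC_ge0 // ltW // L_norm_gt0.
Qed.

(* The eigenvector for the largest eigenvalue of A is a nonnegative multiple of
   its modulus, by the equality case in the Rayleigh bound. *)
Lemma positive_character : exists p, forall k, 0 < L p k.
Proof.
have [p _ tp] := @real_arg_maxP _ _ o xpredT t isT (fun i _ => t_real i).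
exists p; have {}tp i : t i <= t p by exact: tp.
pose z k l := L p l * (L p k)^*.
have ray := rayleigh (fun k => `|L p k|) tp.
have Re_le k l : 0 <= A k l * (`|L p l| * `|L p k| - 'Re (z k l)).
  rewrite mulr_ge0 ?A_ge0 // subr_ge0 -[`|L p k|]norm_conjC -normrM.
  exact: (leif_Re_Creal _).1.
(* The terms are nonnegative, and their sum is at most 0 by the Rayleigh bound for the moduli of
   [L p], since [L p] itself attains [t p]. *)
have eq0 : \sum_k \sum_l A k l * (`|L p l| * `|L p k| - 'Re (z k l)) = 0.
  apply/le_anti/andP; split; last by do 2![apply: sumr_ge0 => ? _].
  have -> : \sum_k \sum_l A k l * (`|L p l| * `|L p k| - 'Re (z k l)) =
    (\sum_k (\sum_l A k l * `|L p l|) * `|L p k|^*) -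
    'Re (t p * \sum_k `|L p k| * `|L p k|^*).
    rewrite mulr_sumr raddf_sum -sumrB; apply: eq_bigr => k _.
    rewrite (CrealP (normr_real _)) -expr2 normCK mulrA -A_eigen.
    rewrite !mulr_suml raddf_sum -sumrB; apply: eq_bigr => l _ /=.
    rewrite mulrBr -!mulrA -/(z k l); congr (_ - _).
    by rewrite ReMl // realE A_ge0.
  have Creal : t p * (\sum_k `|L p k| * `|L p k|^*) \is Num.real.
    rewrite rpredM // rpred_sum // => k _; rewrite ger0_real //.
    exact: mul_conjC_ge0.
  by rewrite (Creal_ReP _ Creal) subr_le0.
(* All terms vanish; in the row of the unit, where [L p o] is 1 and the weight is nonzero, this says
   that [L p k] equals its modulus. *)
have Lp_ge0 k : 0 <= L p k.
  have eq0o : \sum_l A o l * (`|L p l| * `|L p o| - 'Re (z o l)) = 0.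
    by apply: (psumr_eq0P _ eq0) => // l _; apply: sumr_ge0.
  have /eqP : A o k * (`|L p k| * `|L p o| - 'Re (z o k)) = 0.
    exact: (psumr_eq0P _ eq0o).
  rewrite mulf_eq0 A_sym (negPf (A_unit k)) /= /z L_one conjC1 normr1 !mulr1.
  by rewrite subr_eq0 eq_sym (leif_Re_Creal _).2.
(* A zero is excluded because $x_k x_k^*$ contains the unit, so [L p] is at least 1 on it. *)
move=> k; rewrite lt_neqAle Lp_ge0 andbT eq_sym; apply/eqP => Lk.
have := L_mul_conj p k; rewrite Lk mul0r (bigD1 o) //=.
rewrite dual_coord_unit L_one mul1r.
move/esym/eqP; rewrite gt_eqF // (lt_le_trans ltr01) // lerDl sumr_ge0 //.
by move=> b _; rewrite mulr_ge0 ?dual_coord_ge0.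
Qed.

(** Let [q] maximize the ratio of [|L i k|] to [L p k]. The triangle inequality in the expansion of
    [L i j * L i q] bounds it by that ratio times [L p j * L p q]. *)
Lemma positive_character_max p i j : (forall k, 0 < L p k) -> `|L i j| <= L p j.
Proof.
move=> Lp; have r_real k : `|L i k| / L p k \is Num.real.
  by rewrite ger0_real // divr_ge0 // ltW.
have [q _ rq] := @real_arg_maxP _ _ o xpredT _ isT (fun k _ => r_real k).
have {}rq k : `|L i k| <= `|L i q| / L p q * L p k.
  by rewrite -ler_pdivrMr //; exact: rq.
have q0 : 0 < `|L i q|.
  rewrite normr_gt0; apply/eqP => Lq.
  by have := rq o; rewrite Lq normr0 !mul0r L_one normr1 ler10.
rewrite -(ler_pM2r q0) -normrM L_mul; apply: le_trans (ler_norm_sum _ _ _) _.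
apply: (@le_trans _ _ (\sum_a `|L i q| / L p q * ((N j q a)%:R * L p a))).
  by apply: ler_sum => a _; rewrite normrM normr_nat mulrCA ler_wpM2l ?ler0n.
by rewrite -mulr_sumr -L_mul mulrCA divfK // gt_eqF.
Qed.

(** When [L p] is the Frobenius-Perron character, this is being grouplike in the dual, written in
    values; see [dual_grouplikeP]. *)
Definition dual_grouplike_char p j := forall i, L j i * (L j i)^* = L p i ^+ 2.

Lemma burnside_equivalence p : (forall k, 0 < L p k) ->
  (forall i, (exists j, L j i = 0) <-> ~ ring_grouplike i) <->
  (forall j, (exists i, L j i = 0) <-> ~ dual_grouplike_char p j).
Proof.
move=> Lp_gt0.
have Lp0 k : L p k != 0 by rewrite gt_eqF.
have L_transpose i j : L j i = L i j * d i / d j by rewrite S_sym mulfK ?d_neq0.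
have L_transpose0 i j : L j i = 0 -> L i j = 0.
  by move=> Lji; rewrite L_transpose Lji !mul0r.
pose sq (x : F) := x * x^*.
have sqM x y : sq (x * y) = sq x * sq y by rewrite /sq rmorphM mulrACA.
have sqV x : sq x^-1 = (sq x)^-1 by rewrite /sq fmorphV invfM.
have sq_L i j : sq (L j i) = sq (L i j) * sq (d i) / sq (d j).
  by rewrite {1}L_transpose !sqM sqV.
have sq_d0 i : sq (d i) != 0 by rewrite mulf_neq0 ?conjC_eq0 ?d_neq0.
have sq1 : sq 1 = 1 by rewrite /sq mul1r conjC1.
have Lp_conj k : L p k ^+ 2 = sq (L p k).
  by rewrite /sq (CrealP (ger0_real (ltW (Lp_gt0 k)))) expr2.
split=> burn.
(* Burnside gives dual-Burnside: if [L j] has no zeros, then by transposition no character vanishes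
   at $x_j$, so $x_j$ is grouplike. *)
- have gl j : (forall i, L j i != 0) -> ring_grouplike j.
    move=> Lj; apply: contrapT => /burn[i /L_transpose0/eqP].
    by rewrite (negPf (Lj i)).
  have sq_gl j : (forall i, L j i != 0) -> forall i, sq (L i j) = 1.
    by move=> /gl/grouplike_norm gj i; exact: gj.
  move=> j; split=> [[i Lji] gj|ngj].
    have := gj i; rewrite Lji mul0r => /esym/eqP.
    by rewrite expf_eq0 /= (negPf (Lp0 i)).
  apply: contrapT => /forallNP nLj; apply: ngj => i.
  have Lj k : L j k != 0 by apply/eqP/nLj.
  (* Transposition at the unit compares [d o] with [d k]. Applied to [j] and [p], it gives
     $|L_j(x_i)|^2$ and $|L_p(x_i)|^2$ the common value $|d_i|^2/|d_o|^2$. *)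
  have sqd k : (forall i, L k i != 0) -> sq (d o) = sq (d k).
    move=> Lk; have := sq_L o k; rewrite L_one sq1 (sq_gl _ Lk) mul1r.
    by move=> /(congr1 (fun x => x * sq (d k))); rewrite mul1r divfK.
  rewrite -/(sq (L j i)) Lp_conj !(sq_L i) !sq_gl // !mul1r.
  by rewrite -(sqd j Lj) -(sqd p Lp0).
have dgl j : (forall i, L j i != 0) -> forall i, sq (L j i) = sq (L p i).
  move=> Lj i; rewrite -Lp_conj.
  suff: dual_grouplike_char p j by exact.
  by apply: contrapT => /burn[l /eqP]; rewrite (negPf (Lj l)).
move=> i; split=> [[j Lji] /grouplike_norm/(_ j)|ngi].
  by rewrite Lji mul0r => /esym/eqP; rewrite oner_eq0.
apply: contrapT => /forallNP nLi; apply: ngi.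
have Li k : L i k != 0 by apply/eqP => /L_transpose0; exact: nLi.
have Lo k : L o k != 0.
  by apply/eqP => /L_transpose0/eqP; rewrite L_one oner_eq0.
(* Transposing $|L_k(x_i)|^2$ leaves $|L_i(x_k)|^2 = |L_o(x_k)|^2$, whose own transposition gives
   $|d_k|^2/|d_o|^2$; the dependence on [k] cancels. *)
pose c := sq (d i) / sq (d o).
have sqLi k : L k i * (L k i)^* = c.
  rewrite -/(sq _) sq_L (dgl i Li) -(dgl o Lo) [sq (L o k)]sq_L L_one sq1 mul1r.
  move: (sq_d0 k); rewrite /c; move: (sq (d k)) (sq (d o)) (sq (d i)) => x y w x0.
  by rewrite mulrC -!mulrA mulKf // mulrC.
have coordE b : dual_coord i b = c * (b == o)%:R.
  apply/eqP; rewrite -subr_eq0; apply/eqP; move: b.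
  apply: L_separates => k; under eq_bigr do rewrite mulrC mulrBl.
  rewrite sumrB -L_mul_conj sqLi (bigD1 o) //= eqxx mulr1 L_one.
  rewrite big1 ?addr0 ?mulr1 ?subrr // => b /negPf->.
  by rewrite mulr0 mul0r.
have c1 : c = 1 by have := coordE o; rewrite dual_coord_unit eqxx mulr1.
by move=> b; rewrite coordE c1 mul1r.
Qed.

End FusionRing.

(** * The Grothendieck ring and its dual *)

Section Grothendieck.
Variables (R : realType) (C : modular_category R[i]).
Variables (m : nat) (X : 'I_m -> C).
Local Notation N := (fusion_coef X).
Local Notation D := (dual_mult X).

Lemma xclE (A : comNzRingType) (i j : 'I_m) :
  xcl A i 0 j = (i == j)%:R.
Proof. by rewrite mxE eqxx eq_sym. Qed.

Lemma kclassE (A : comNzRingType) (Y : C) l :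
  kclass A X Y 0 l = (multiplicity (X l) Y)%:R.
Proof.
rewrite summxE (bigD1 l) //= mxE xclE eqxx mulr1 big1 ?addr0 // => a al.
by rewrite mxE xclE (negPf al) mulr0.
Qed.

Lemma KmulE (A : comNzRingType) (u v : 'rV[A]_m) b :
  Kmul X u v 0 b = \sum_i \sum_j u 0 i * v 0 j * (N i j b)%:R.
Proof.
rewrite summxE; apply: eq_bigr => i _; rewrite summxE; apply: eq_bigr => j _.
by rewrite mxE kclassE.
Qed.

Lemma Kmul_xclE (A : comNzRingType) i (v : 'rV[A]_m) b :
  Kmul X (xcl A i) v 0 b = \sum_j v 0 j * (N i j b)%:R.
Proof.
rewrite KmulE (bigD1 i) //= [X in _ + X]big1 ?addr0 => [|a ai].
  by apply: eq_bigr => j _; rewrite xclE eqxx mul1r.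
by rewrite big1 // => j _; rewrite xclE eq_sym (negPf ai) !mul0r.
Qed.

Lemma form_of_linear (w : 'I_m -> R[i]) :
  linear (fun u : Kalg R m => \sum_(i < m) u 0 i * w i : R[i]^o).
Proof.
move=> a u v; rewrite scaler_sumr -big_split /=; apply: eq_bigr => i _.
by rewrite !mxE mulrDl -mulrA.
Qed.

Lemma form_ofE (w : 'I_m -> R[i]) (u : Kalg R m) :
  form_of w u = \sum_(i < m) u 0 i * w i.
Proof. by rewrite (linear_linfunE (form_of_linear w)). Qed.

Lemma form_of_xcl (w : 'I_m -> R[i]) i : form_of w (xcl _ i) = w i.
Proof.
rewrite form_ofE (bigD1 i) //= xclE eqxx mul1r big1 ?addr0 // => j ji.
by rewrite xclE eq_sym (negPf ji) mul0r.
Qed.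

Lemma form_of_scale (w : 'I_m -> R[i]) c i : form_of w (c *: xcl _ i) = c * w i.
Proof. by rewrite linearZ /= form_of_xcl. Qed.

Lemma form_sum (mu : Kdual R m) (u : Kalg R m) :
  mu u = \sum_i u 0 i * mu (xcl _ i).
Proof.
rewrite {1}[u]row_sum_delta linear_sum.
by apply: eq_bigr => i _; rewrite linearZ.
Qed.

Lemma form_of_eta (mu : Kdual R m) : mu = form_of (fun i => mu (xcl _ i)).
Proof. by apply/lfunP => u; rewrite form_ofE form_sum. Qed.

Lemma form_of_ext (v w : 'I_m -> R[i]) : v =1 w -> form_of v = form_of w.
Proof. by move=> /funext ->. Qed.

Variables (o : 'I_m) (L : 'I_m -> 'I_m -> R[i]) (d : 'I_m -> R[i]).
Hypothesis unit_o : forall l, multiplicity (X l) tunit = (l == o).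
Hypothesis N_unit : forall i l, N o i l = (i == l).
Hypothesis N_dual : forall i j l,
  \sum_a (D i a)%:R * (N a j l)%:R = (N i l j)%:R :> R[i].
Hypothesis L_mul : forall i j l, L i j * L i l = \sum_a (N j l a)%:R * L i a.
Hypothesis S_unit : \matrix_(i < m, j < m) (L i j * d i) \in unitmx.
Hypothesis S_sym : forall i j, L i j * d i = L j i * d j.

Lemma KoneE (A : comNzRingType) : Kone A X = xcl A o.
Proof.
by apply/rowP => l; rewrite kclassE unit_o xclE eq_sym.
Qed.

Lemma is_character_L j : is_character X (form_of (L j)).
Proof.
split=> [|u v].
  by rewrite KoneE form_of_xcl (L_one N_unit L_mul S_unit).
rewrite !form_ofE mulr_suml.
under eq_bigr => b _ do rewrite KmulE mulr_suml.
rewrite exchange_big /=; apply: eq_bigr => i _.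
under eq_bigr => b _ do rewrite mulr_suml.
rewrite exchange_big /= mulr_sumr; apply: eq_bigr => l _.
rewrite mulrACA L_mul mulr_sumr; apply: eq_bigr => b _.
exact/esym/mulrA.
Qed.

(** Expand [mu] in the basis of the [L k]: as with independence of characters, a nonzero coefficient
    forces [mu] to agree with that [L k]. *)
Lemma is_characterP (mu : Kdual R m) :
  is_character X mu <-> exists j, mu = form_of (L j).
Proof.
split=> [[mu1 muM]|[j ->]]; last exact: is_character_L.
have [c wE] := L_spans S_unit (fun i => mu (xcl _ i)).
have [k ck] : exists k, c k != 0.
  apply: contrapT => /forallNP c0; have := wE o; rewrite -KoneE mu1 big1.
    by move/eqP; rewrite oner_eq0.
  by move=> k _; have /negP/negPn/eqP ck := c0 k; rewrite ck mul0r.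
exists k; rewrite [LHS]form_of_eta; apply: form_of_ext => i.
(* The equation $\mu(x_i x_l) = \mu(x_i)\mu(x_l)$ with $\mu$ expanded, as a linear relation among
   the characters. *)
have key : forall l, \sum_k c k * (L k i - mu (xcl _ i)) * L k l = 0.
  move=> l; have : mu (Kmul X (xcl _ i) (xcl _ l)) = mu (xcl _ i) * mu (xcl _ l).
    exact: muM.
  rewrite [mu (Kmul _ _ _)]form_sum.
  have KE b : Kmul X (xcl R[i] i) (xcl _ l) 0 b = (N i l b)%:R.
    rewrite Kmul_xclE (bigD1 l) //= xclE eqxx mul1r big1 ?addr0 // => a al.
    by rewrite xclE eq_sym (negPf al) mul0r.
  under eq_bigr => b _ do rewrite KE wE mulr_sumr.
  rewrite exchange_big /= [mu (xcl _ l)]wE mulr_sumr => /eqP.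
  rewrite -subr_eq0 -sumrB => /eqP e; rewrite -[RHS]e; apply: eq_bigr => q _.
  under [in RHS]eq_bigr => b _ do rewrite mulrCA.
  rewrite -mulr_sumr -L_mul mulrBr mulrBl -!mulrA; congr (_ - _).
  by rewrite mulrCA.
have /eqP := L_free S_unit key k.
by rewrite mulf_eq0 (negPf ck) subr_eq0 => /eqP.
Qed.

Lemma grouplikeP i : grouplike X i <-> ring_grouplike R[i] N D o i.
Proof.
have E b : (Kmul X (xcl int i) (kclass int X (ldual (X i))) 0 b)%:~R =
    dual_coord R[i] N D i b.
  rewrite Kmul_xclE rmorph_sum /=; apply: eq_bigr => a _.
  by rewrite rmorphM /= kclassE !natz.
rewrite /grouplike KoneE; split=> [gi b|gi].
  by rewrite -E gi xclE eq_sym; case: eqP.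
apply/rowP => b; apply: (@intr_inj R[i]); rewrite E gi xclE eq_sym.
by case: eqP.
Qed.

Lemma BurnsideP : Burnside X <->
  forall i, (exists j, L j i = 0) <-> ~ ring_grouplike R[i] N D o i.
Proof.
have E i : (exists mu, is_character X mu /\ mu (xcl _ i) = 0) <->
    exists j, L j i = 0.
  split=> [[mu [/is_characterP[j ->]]]|[j Lji]].
    by rewrite form_of_xcl => Lji; exists j.
  exists (form_of (L j)); rewrite form_of_xcl; split=> //.
  exact: is_character_L.
split=> B i; first by rewrite -E -grouplikeP.
by rewrite E grouplikeP.
Qed.

(** * The Frobenius-Perron character and the dual hypergroup *)

Variable p : 'I_m.
Hypothesis Lp_gt0 : forall k, 0 < L p k.

Lemma dimCE i : dimC X i = L p i.
Proof.
have Lp_real k : (complex.Re (L p k))%:C%C = L p k.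
  by apply: RRe_real; apply: gtr0_real.
rewrite -[RHS]Lp_real /dimC; congr (_%:C)%C.
rewrite /FPdim; set M := lin1_mx _; set E := (X in sup X).
have ME (v : 'rV[R]_m) b : (v *m M) 0 b = \sum_k v 0 k * (N i k b)%:R.
  rewrite mxE; apply: eq_bigr => k _; congr (_ * _); rewrite mxE.
  rewrite Kmul_xclE (bigD1 k) //= mxE !eqxx mul1r big1 ?addr0 // => a ak.
  by rewrite mxE (negPf ak) andbF mul0r.
have E_ub : ubound E (complex.Re (L p i)).
  move=> r [r0 /eigenvalueP[v vM v0]].
  (* Some character [L j] is nonzero on the eigenvector [v]; applied to $x_i v = r v$ it gives $r =
     L_j(x_i)$. *)
  have [j vLj] : exists j, \sum_b L j b * (v 0 b)%:C%C != 0.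
    apply: contrapT => /forallNP vL0; case/eqP: v0; apply/rowP => b.
    rewrite mxE; apply: (@complexI R).
    apply: (L_separates S_unit (v := fun b => (v 0 b)%:C%C)) => j.
    by apply/eqP/negPn/negP/vL0.
  have rE : r%:C%C = L j i.
    apply: (mulIf vLj); rewrite !mulr_sumr.
    transitivity (\sum_b \sum_k (v 0 k)%:C%C * (N i k b)%:R * L j b).
      apply: eq_bigr => b _; have := congr1 (fun u : 'rV_m => u 0 b) vM.
      rewrite ME mxE => /(congr1 (real_complex R)).
      rewrite rmorphM rmorph_sum /= => e; rewrite mulrCA -e mulrC mulr_suml.
      by apply: eq_bigr => k _; rewrite rmorphM /= rmorph_nat.
    rewrite exchange_big /=; apply: eq_bigr => k _.
    rewrite mulrA L_mul mulr_suml; apply: eq_bigr => b _.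
    by rewrite -mulrA mulrC.
  rewrite -lecR Lp_real; apply: le_trans (real_ler_norm _) _.
    by rewrite complex_real.
  rewrite rE; exact: (positive_character_max N_unit L_mul S_unit).
(* The positive row [L p] is an eigenvector by [dual_eigen], with eigenvalue the conjugate of the
   real number [L p i]. *)
have E_in : E (complex.Re (L p i)).
  split; first by rewrite -lecR Lp_real ltW.
  apply/eigenvalueP; exists (\row_k complex.Re (L p k)).
    apply/rowP => b; rewrite ME; apply: (@complexI R).
    rewrite rmorph_sum !mxE rmorphM /= !Lp_real.
    have := dual_eigen N_dual L_mul p i b.
    rewrite (L_dual N_unit N_dual L_mul S_unit).
    rewrite (CrealP (gtr0_real (Lp_gt0 i))) => ->; apply: eq_bigr => k _.
    by rewrite rmorphM mxE /= Lp_real rmorph_nat mulrC.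
  apply/eqP => /rowP/(_ i); rewrite !mxE => /(congr1 (real_complex R)) /=.
  by rewrite Lp_real => /eqP; rewrite gt_eqF.
apply/le_anti/andP; split.
  by apply: ge_sup => //; exists (complex.Re (L p i)).
by apply: ub_le_sup => //; exists (complex.Re (L p i)).
Qed.

Lemma FPcharE : FPchar X = form_of (L p).
Proof. by apply: form_of_ext => i; exact: dimCE. Qed.

(** By [L_dual], [sharp] conjugates the values of a character; the normalization by [dimC] leaves
    one factor [L p i] in the denominator. *)
Lemma starE j : star X (form_of (L j)) (sharp X (form_of (L j))) =
  form_of (fun i => L j i * (L j i)^* / L p i).
Proof.
apply: form_of_ext => i /=; rewrite /sharp !form_of_scale dimCE.
have -> : form_of (L j) (kclass R[i] X (ldual (X i))) = (L j i)^*.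
  rewrite form_ofE -(L_dual N_unit N_dual L_mul S_unit).
  by apply: eq_bigr => a _; rewrite kclassE.
have Lpi : L p i != 0 by rewrite gt_eqF.
by rewrite mulrA mulVKf // mulrCA mulrC.
Qed.

(** The family chosen by [xget] is some expansion of the product in characters, and their
    independence forces its coefficient at [FPchar X]. *)
Lemma dual_coef_FPchar mu nu : star X mu nu = FPchar X ->
  dual_coef X mu nu (FPchar X) = 1.
Proof.
move=> starE; rewrite /dual_coef; set P := (X in xget _ X).
(* The set of characters is enumerated without repetition by the rows of [L]. *)
have gE q : \sum_(ka \in characters X) q ka *: ka =
    \sum_j q (form_of (L j)) *: form_of (L j) :> Kdual R m.
  have g_inj : injective (fun j => form_of (L j)).
    move=> i j ij; apply: (L_inj S_unit) => b.
    by rewrite -!form_of_xcl ij.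
  have -> : characters X =
      [set` [seq form_of (L j) | j <- index_enum 'I_m]]%classic.
    apply/seteqP; split=> ka /=.
      by move=> /is_characterP[j ->]; apply: map_f; rewrite mem_index_enum.
    by move=> /mapP[j _ ->]; apply: is_character_L.
  by rewrite -fsbig_seq ?map_inj_uniq ?index_enum_uniq // big_map.
have Pex : exists q, P q.
  exists (fun ka => (ka == FPchar X)%:R); rewrite /P /= starE gE (bigD1 p) //=.
  rewrite -FPcharE eqxx scale1r big1 ?addr0 // => j jp.
  rewrite FPcharE; case: eqP => [e|_]; last by rewrite scale0r.
  case/eqP: jp; apply: (L_inj S_unit) => b.
  by rewrite -!form_of_xcl e.
have : P (xget (fun=> 0) P) by exact: xgetPex.
move: (xget _ _) => q; rewrite /P /= starE gE FPcharE => e.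
have key : forall b, \sum_j (q (form_of (L j)) - (j == p)%:R) * L j b = 0.
  move=> b; have := congr1 (fun f : Kdual R m => f (xcl _ b)) e.
  rewrite sum_lfunE form_of_xcl.
  under eq_bigr => j _ do rewrite scale_lfunE form_of_xcl.
  move=> eb; under eq_bigr do rewrite mulrBl.
  rewrite sumrB -[X in X - _]eb (bigD1 p) //= eqxx mul1r big1 ?addr0 ?subrr //.
  by move=> j /negPf->; rewrite mul0r.
have /eqP := L_free S_unit key p.
by rewrite eqxx subr_eq0 => /eqP.
Qed.

Lemma dual_grouplikeP j :
  dual_grouplike X (form_of (L j)) <-> dual_grouplike_char L p j.
Proof.
rewrite /dual_grouplike; set c := dual_coef _ _ _ _.
have Lo q : L q o = 1 by exact: (L_one N_unit L_mul S_unit).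
split=> [|gj].
  rewrite starE FPcharE => e i.
  have ei b := congr1 (fun f : Kdual R m => f (xcl _ b)) e.
  (* At the unit all characters take the value 1, so evaluation there determines the coefficient. *)
  have c1 : c = 1.
    have := ei o; rewrite scale_lfunE !form_of_xcl !Lo conjC1 mulr1 divr1.
    by rewrite -[_ *: _]/(_ * _) mulr1.
  have := ei i; rewrite scale_lfunE !form_of_xcl c1 scale1r.
  by move/(congr1 (fun x => x * L p i)); rewrite divfK ?gt_eqF // expr2.
have e : star X (form_of (L j)) (sharp X (form_of (L j))) = FPchar X.
  rewrite starE FPcharE; apply: form_of_ext => i.
  by rewrite gj expr2 mulfK ?gt_eqF.
by rewrite /c dual_coef_FPchar // scale1r.
Qed.

Lemma dual_BurnsideP : dual_Burnside X <->
  forall j, (exists i, L j i = 0) <-> ~ dual_grouplike_char L p j.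
Proof.
have E j : (exists i, form_of (L j) (xcl R[i] i) = 0) <-> exists i, L j i = 0.
  by split=> -[l Ljl]; exists l; rewrite ?form_of_xcl // -(form_of_xcl (L j)).
split=> B.
  by move=> j; rewrite -E -dual_grouplikeP; apply: B; apply: is_character_L.
by move=> mu /is_characterP[j ->]; rewrite E dual_grouplikeP.
Qed.

End Grothendieck.

(** * Burnside and dual-Burnside properties of a modular category *)

Theorem corollary10p3 (R : realType) (C : modular_category R[i])
    (m : nat) (X : 'I_m -> C) (hX : simple_representatives X) :
  Burnside X <-> dual_Burnside X.
Proof.
have [o [unit_o N_unit]] := fusion_data_unit hX.
have [L [d [L_mul SE]]] := S_characters hX.
have N_dual i j l : \sum_a (dual_mult X i a)%:R * (fusion_coef X a j l)%:R =
    (fusion_coef X i l j)%:R :> R[i].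
  rewrite -(fusion_reciprocity hX) natr_sum; apply: eq_bigr => a _.
  by rewrite -natrM.
have S_unit : \matrix_(i < m, j < m) (L i j * d i) \in unitmx.
  suff -> : \matrix_(i < m, j < m) (L i j * d i) = Smatrix X.
    exact: modular_nondegenerate.
  by apply/matrixP => i j; rewrite !mxE -SE mxE.
have S_sym i j : L i j * d i = L j i * d j by rewrite -!SE Smatrix_sym.
have [p Lp_gt0] := positive_character N_unit N_dual L_mul S_unit.
rewrite (BurnsideP unit_o N_unit L_mul S_unit).
rewrite (dual_BurnsideP unit_o N_unit N_dual L_mul S_unit Lp_gt0).
exact: (burnside_equivalence N_unit N_dual L_mul S_unit S_sym Lp_gt0).
Qed.
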